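(* Fix $k\in\mathbb{N}$ and $\beta\in(0,\infty)$, and let $\alpha=\beta\sqrt{n}$. Then, as $n\to\infty$, $$d_{TV}(M_{n,k}^{\alpha},M_{n,k}^{\infty})\to \tfrac12\,\mathbb{E}\bigl|1-\exp(-\mathcal{N})\bigr|,$$ where $\mathcal{N}$ is a Gaussian random variable with $\mathbb{E}[\mathcal{N}]=\frac{k^2}{4\beta^2}$ and $\mathrm{Var}[\mathcal{N}]=\frac{k^2}{2\beta^2}$.
   Context: A $k$-out map on $[n]$ is a map $M:[n]\to[n]^k$, viewed as a digraph on $[n]$ in which each vertex has $k$ out-arcs labeled $1,\dots,k$; $\mathcal{M}_{n,k}$ denotes the set of all such maps. The in-degree $d_j$ of vertex $j$ is the total number of coordinates, over all vertices $i$ and all $k$ labels, of $M(i)$ equal to $j$ (so $d_1+\dots+d_n=kn$). For $\alpha\in(0,\infty)$, the random $k$-out map $M_{n,k}^{\alpha}$ is generated by inserting $kn$ out-arcs, $k$ per vertex: every vertex starts with weight $\alpha$; at each step a vertex whose out-degree is below $k$ picks its next image $j$ with probability proportional to the current weight of $j$, and the weight of $j$ then increases by $1$. Its law is $P(M_{n,k}^{\alpha}=M)=\prod_{j=1}^n \alpha^{\overline{d_j}}/(\alpha n)^{\overline{kn}}$, where $(d_1,\dots,d_n)$ is the in-degree sequence of $M$ and $x^{\overline{y}}=x(x+1)\cdots(x+y-1)$. $M_{n,k}^{\infty}$ denotes the uniformly random element of $\mathcal{M}_{n,k}$ (probability $n^{-kn}$ each). $d_{TV}(M_{n,k}^{\alpha},M_{n,k}^{\infty})=\sup_{\mathcal{A}\subseteq\mathcal{M}_{n,k}}|P(M_{n,k}^{\alpha}\in\mathcal{A})-P(M_{n,k}^{\infty}\in\mathcal{A})|$.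 *)

(* Defs.v *)
From HB Require Import structures.
From mathcomp Require Import all_boot all_order all_algebra.
From mathcomp Require Import all_classical all_reals all_analysis.
Set Implicit Arguments. Unset Strict Implicit. Unset Printing Implicit Defensive.
Import Order.TTheory GRing.Theory Num.Theory.
Local Open Scope ring_scope.

Definition kmap (n k : nat) := {ffun 'I_n -> {ffun 'I_k -> 'I_n}}.

Definition indeg (n k : nat) (M : kmap n k) (j : 'I_n) : nat :=
  #|[set p : 'I_n * 'I_k | M p.1 p.2 == j]|.

Definition rising (R : realType) (x : R) (y : nat) : R :=
  \prod_(i < y) (x + i%:R).

Definition palpha (R : realType) (n k : nat) (alpha : R) (M : kmap n k) : R :=
  (\prod_(j < n) rising alpha (indeg M j)) / rising (alpha * n%:R) (k * n).

Definition punif (R : realType) (n k : nat) (M : kmap n k) : R :=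
  (n%:R ^+ (k * n))^-1.

Definition probA (R : realType) (n k : nat) (p : kmap n k -> R)
  (A : {set kmap n k}) : R := \sum_(M in A) p M.

Definition dTV (R : realType) (n k : nat) (p q : kmap n k -> R) : R :=
  \big[Num.max/0]_(A : {set kmap n k}) `|probA p A - probA q A|.

(* Main.v *)
Require Import Defs.
From HB Require Import structures.
From mathcomp Require Import all_boot all_order all_algebra.
From mathcomp Require Import all_classical all_reals all_analysis.
From mathcomp Require Import measurable_realfun ring lra.
Import Order.TTheory GRing.Theory Num.Theory.
Import numFieldNormedType.Exports.
Local Open Scope classical_set_scope.
Local Open Scope ring_scope.

(** Both laws have total mass one, so the total variation distance is
    [E (1 - exp (- X))^+] under the uniform law, where [exp (- X)] is the
    likelihood ratio; in the same way the limit is [E (1 - exp (- N))^+], because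
    [E (exp (- N)) = 1].  The function [(1 - exp (- x))^+] is bounded and
    1-Lipschitz, so it is enough that [X] converges to [N] in distribution.

    Under the uniform law the [k n] images are independent uniform draws
    from [n] urns, and [exp (- X)] is the product over the draws of
    [(1 + c / alpha) / (1 + t / (alpha n))], where [t] is the number of earlier
    draws and [c] the number of those that fell in the same urn.  Given the
    past, an increment of [X] has mean about [v / 2] and second moment about
    [v = t / (n alpha^2)], because the second moment of the urn contents
    concentrates (the centred number of collisions is a martingale).  Hence
    [E (cos (a X + phi)) exp (a^2 V / 2)], with phase corrected by [- a V / 2],
    is almost constant along the draws, where [V] is the sum of the [v].
    This gives the limits of [E (cos (a X + phi))], and a bound on [E |X|]
    together with Bernstein polynomials in [sin (theta x)] pass from
    trigonometric to bounded Lipschitz test functions. *)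

(** * The normal distribution *)

Section normal_density_change.
Context {R : realType}.
Variables (m s : R).
Local Notation mu := (@lebesgue_measure R).
Local Notation pdf := (normal_pdf m s).

Lemma measurable_EFin_normal_pdf : measurable_fun [set: R] (EFin \o pdf : R -> \bar R).
Proof. by apply/measurable_EFinP; exact: measurable_normal_pdf. Qed.

Import HBNNSimple.

Lemma integral_normal_prob_nnsfun (f : {nnsfun measurableTypeR R >-> R}) :
  (\int[normal_prob m s]_x (f x)%:E = \int[mu]_x ((f x)%:E * (pdf x)%:E))%E.
Proof.
under [LHS]eq_integral do rewrite fimfunE -fsumEFin//.
rewrite [LHS]ge0_integral_fsum//; last 2 first.
  - by move=> r; exact/measurable_EFinP/measurableT_comp.
  - by move=> n x _; rewrite EFinM nnfun_muleindic_ge0.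
under [RHS]eq_integral.
  move=> x xD; rewrite fimfunE -fsumEFin// muleC ge0_mule_fsumr; last first.
    by move=> r; rewrite EFinM nnfun_muleindic_ge0.
  over.
rewrite [RHS]ge0_integral_fsum//; last 2 first.
  - move=> r; apply: emeasurable_funM; first exact: measurable_EFin_normal_pdf.
    by apply/measurable_EFinP; do 2 apply/measurableT_comp => //.
  - move=> n x _; rewrite EFinM mule_ge0//; last by rewrite nnfun_muleindic_ge0.
    by rewrite lee_fin normal_pdf_ge0.
apply: eq_fsbigr => r; rewrite inE/= => -[t _ ft].
have r0 : 0 <= r by rewrite -ft.
have mE : measurable (f @^-1` [set r]) by exact: measurable_sfunP.
under [LHS]eq_integral do rewrite EFinM.
rewrite ge0_integralZl//; last exact/measurable_EFinP/measurable_indic.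
under [RHS]eq_integral do rewrite EFinM muleCA.
rewrite [RHS]ge0_integralZl//; last 2 first.
  - apply: emeasurable_funM; first exact: measurable_EFin_normal_pdf.
    exact/measurable_EFinP/measurable_indic.
  - by move=> x _; rewrite mule_ge0// lee_fin// normal_pdf_ge0.
congr (_ * _)%E.
rewrite integral_indic//= setIT /normal_prob [LHS]integral_mkcond/=.
apply: eq_integral => x _; rewrite patchE indicE.
by case: (x \in _); rewrite ?mule1 ?mule0.
Qed.

(** On simple functions the identity holds because the measure of a set is by definition the
    integral of the density over it; monotone convergence along simple approximations does the
    rest. *)
Lemma integral_normal_prob (f : R -> R) : measurable_fun setT f ->
  (forall x, 0 <= f x) ->
  (\int[normal_prob m s]_x (f x)%:E = \int[mu]_x (f x * pdf x)%:E)%E.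
Proof.
move=> mf0 f0.
have mf : measurable_fun setT (EFin \o f : measurableTypeR R -> \bar R) by exact/measurable_EFinP.
pose f_ := nnsfun_approx measurableT mf.
have cf (x : R) : (EFin \o f_^~ x) n @[n --> \oo] --> (f x)%:E.
  by apply: cvg_nnsfun_approx => //= y _; rewrite lee_fin.
transitivity (lim (\int[normal_prob m s]_x (f_ n x)%:E @[n --> \oo])%E).
  rewrite -monotone_convergence//=.
  - by apply: eq_integral => x xD; apply/esym/cvg_lim => //=; exact: cf.
  - by move=> n; exact/measurable_EFinP/measurable_funTS.
  - by move=> n ? _; rewrite lee_fin.
  - by move=> ? _ ? ? mn; rewrite lee_fin; exact/lefP/nd_nnsfun_approx.
transitivity (lim (\int[mu]_x ((f_ n x)%:E * (pdf x)%:E) @[n --> \oo])%E).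
  by apply: congr_lim; apply/funext => n; exact: integral_normal_prob_nnsfun.
rewrite -monotone_convergence//=.
- apply: eq_integral => x xD; apply/cvg_lim => //=.
  rewrite EFinM; apply: cvgeZr => //; exact: cf.
- move=> n; apply: emeasurable_funM; last exact: measurable_EFin_normal_pdf.
  exact/measurable_EFinP/measurable_funTS.
- by move=> n ? _; rewrite mule_ge0// lee_fin// normal_pdf_ge0.
- move=> x _ ? ? mn; rewrite lee_wpmul2r// lee_fin ?normal_pdf_ge0//.
  exact/lefP/nd_nnsfun_approx.
Qed.
End normal_density_change.

(** * Exponential moments and integrability under the normal density *)

Section normal_exponential.
Context {R : realType}.
Variables (m s : R).
Hypothesis s0 : s != 0.
Local Notation mu := (@lebesgue_measure R).
Local Notation pdf := (normal_pdf m s).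

(** Completing the square: tilting by [expR (t * x)] moves the mean by [t * s ^+ 2] and keeps the
    variance, so exponential moments reduce to the total mass of another normal density. *)
Lemma expR_normal_pdf t x : expR (t * x) * normal_pdf m s x =
  expR (t * m + (t * s) ^+ 2 / 2) * normal_pdf (m + t * s ^+ 2) s x.
Proof.
rewrite !normal_pdfE// /normal_fun.
rewrite [LHS]mulrCA [RHS]mulrCA -!expRD; congr (_ * expR _).
by field.
Qed.

Lemma integrable_expR_normal_pdf t :
  mu.-integrable setT (fun x => (expR (t * x) * pdf x)%:E).
Proof.
under eq_fun do rewrite expR_normal_pdf EFinM.
by apply: integrableZl => //; exact: integrable_normal_pdf.
Qed.

Lemma Rintegral_expR_normal_pdf t :
  (\int[mu]_x (expR (t * x) * pdf x) = expR (t * m + (t * s) ^+ 2 / 2))%R.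
Proof.
under eq_Rintegral do rewrite expR_normal_pdf.
rewrite RintegralZl//; last exact: integrable_normal_pdf.
by rewrite /Rintegral integral_normal_pdf mulr1.
Qed.

(** [|x|] is at most [expR x + expR (- x)], and both exponentials are integrable by tilting. *)
Lemma integrable_affine_normal_pdf (A B : R) :
  mu.-integrable setT (fun x => ((A + B * `|x|) * pdf x)%:E).
Proof.
have h : mu.-integrable setT (fun x =>
   (`|A|%:E * (pdf x)%:E + `|B|%:E * ((expR (1 * x) * pdf x)%:E + (expR (- 1 * x) * pdf x)%:E))%E).
  apply: integrableD => //; first by apply: integrableZl => //; exact: integrable_normal_pdf.
  by apply: integrableZl => //; apply: integrableD => //; exact: integrable_expR_normal_pdf.
apply: le_integrable h => //.
  apply/measurable_EFinP; apply: measurable_funM; last exact: measurable_normal_pdf.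
  by apply: measurable_funD => //; apply: measurable_funM => //; exact: measurableT_comp.
move=> x _ /=; rewrite lee_fin.
have p0 := normal_pdf_ge0 m s x.
have e1 := expR_ge0 (1 * x); have e2 := expR_ge0 (- 1 * x).
rewrite [leRHS]ger0_norm; last by rewrite addr_ge0 ?mulr_ge0 ?addr_ge0 ?mulr_ge0.
rewrite normrM (ger0_norm p0) -mulrDl mulrA -mulrDl ler_wpM2r//.
rewrite (le_trans (ler_normD _ _))// lerD2l normrM ler_wpM2l//.
rewrite normr_id ler_norml mul1r mulN1r.
have h1 := expR_ge1Dx x; have h2 := expR_ge1Dx (- x).
by rewrite mul1r in e1; rewrite mulN1r in e2; apply/andP; split; lra.
Qed.

Lemma integrable_bounded_normal_pdf (f : R -> R) (A B : R) :
  measurable_fun setT f -> (forall x, `|f x| <= A + B * `|x|) ->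
  mu.-integrable setT (fun x => (f x * pdf x)%:E).
Proof.
move=> mf fA; apply: le_integrable (integrable_affine_normal_pdf A B) => //.
  by apply/measurable_EFinP; apply: measurable_funM => //; exact: measurable_normal_pdf.
move=> x _ /=; rewrite lee_fin !normrM ler_wpM2r//.
by rewrite (le_trans (fA x))// ler_norm.
Qed.
End normal_exponential.

(** The fundamental theorem of calculus on [[-n, n]] leaves only boundary terms, which vanish in the
    limit; dominated convergence, with [|f|] as dominating function, passes to the whole line. *)
Lemma Rintegral_derive_eq0 {R : realType} (F f : R -> R) :
  (forall x, is_derive x (1 : R) F (f x)) -> continuous f ->
  (@lebesgue_measure R).-integrable setT (EFin \o f) ->
  F n%:R @[n --> \oo] --> (0 : R) -> F (- n%:R) @[n --> \oo] --> (0 : R) ->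
  (\int[@lebesgue_measure R]_x f x = 0)%R.
Proof.
move=> dF cf intf F0 F0'.
set mu := @lebesgue_measure R in intf *.
have mf : measurable_fun setT (EFin \o f) by exact: measurable_int intf.
have h1 : (\int[mu]_x ((f \_ `[- n%:R, n%:R]) x)%:E @[n --> \oo] --> \int[mu]_x (f x)%:E)%E.
  apply: (@dominated_cvg _ _ _ mu setT _ _ _ (fun x => `|f x|%:E)) => //.
  - move=> n; have -> : (fun x => ((f \_ `[- n%:R, n%:R]) x)%:E) =
        (EFin \o f) \_ `[- n%:R, n%:R] by rewrite restrict_EFin.
    apply/(measurable_restrictT _ _).1 => //.
    exact: measurable_funTS.
  - move=> x _; apply: cvg_near_cst; near=> n => /=.
    rewrite patchE ifT// inE/= in_itv/= -ler_norml.
    by near: n; exact: nbhs_infty_ger.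
  - exact: integrable_norm.
  - move=> n x _; rewrite abse_EFin lee_fin patchE.
    by case: ifP => // _; rewrite normr0.
have h2 : ((F n%:R - F (- n%:R))%:E @[n --> \oo] --> (\int[mu]_x (f x)%:E)%E).
  apply: cvg_trans h1; apply: near_eq_cvg; near=> n.
  transitivity (\int[mu]_(x in `[(- n%:R)%R, n%:R]) (f x)%:E)%E.
    by rewrite [RHS]integral_mkcond -[in RHS]/(EFin \o f) restrict_EFin.
  have n0 : (0 < n)%N by near: n; exact: nbhs_infty_gt.
  rewrite (@continuous_FTC2 _ f F)//.
  - by rewrite gtrN// ltr0n.
  - exact: continuous_subspaceT.
  - split.
    + by move=> x _; exact: ex_derive.
    + apply: cvg_at_right_filter. apply: differentiable_continuous; apply/derivable1_diffP; exact: ex_derive.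
    + apply: cvg_at_left_filter. apply: differentiable_continuous; apply/derivable1_diffP; exact: ex_derive.
  - by move=> x _; rewrite derive1E derive_val.
have h3 : ((F n%:R - F (- n%:R))%:E @[n --> \oo] --> (0 : R)%:E).
  apply: cvg_EFin; first exact: nearW.
  by rewrite -[X in _ --> X](subr0 (0 : R)); exact: cvgB.
by rewrite /Rintegral (cvg_unique _ h2 h3).
Unshelve. all: end_near. Qed.

Section normal_derivative.
Context {R : realType}.
Variables (m s : R).
Hypothesis s0 : s != 0.
Local Notation mu := (@lebesgue_measure R).
Local Notation pdf := (normal_pdf m s).

Lemma is_derive_normal_pdf (x : R) :
  is_derive x (1 : R) pdf (- ((x - m) / s ^+ 2) * pdf x).
Proof.
rewrite normal_pdfE// /normal_fun.
apply: is_derive_eq; rewrite /GRing.scale /=.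
by field.
Qed.

Lemma is_derive_normal_pdf_sin (a phi x : R) :
  is_derive x (1 : R) (fun x => pdf x * sin (a * (x - m) + phi))
   (pdf x * (a * cos (a * (x - m) + phi) - (x - m) / s ^+ 2 * sin (a * (x - m) + phi))).
Proof.
have h := is_derive_normal_pdf x.
apply: is_derive_eq; rewrite /GRing.scale /=.
by field.
Qed.

(** Tilting with [t = 1] bounds [expR x * pdf x] by a constant times the peak of a shifted normal
    density, so the density is at most of order [expR (- x)]. *)
Lemma cvg_normal_pdf_nat : pdf n%:R @[n --> \oo] --> (0 : R).
Proof.
pose C := expR (1 * m + (1 * s) ^+ 2 / 2) * normal_peak s.
apply: (@squeeze_cvgr _ _ _ _ (cst 0) (fun n => C * expR (- n%:R))).
- near=> n; rewrite /= normal_pdf_ge0/= expRN ler_pdivlMr ?expR_gt0//.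
  rewrite mulrC -[X in expR X]mul1r expR_normal_pdf// ler_wpM2l ?expR_ge0//.
  exact: normal_pdf_ub.
- exact: cvg_cst.
- rewrite -[X in _ --> X](mulr0 C); apply: cvgMl_tmp.
  exact: (@cvg_comp _ _ _ _ (fun x : R => expR (- x)) _ _ _ (@cvgr_idn R) (@cvgr_expR R)).
Unshelve. all: end_near. Qed.
End normal_derivative.

(** * Cosine integrals of the normal law *)

Section normal_cosine.
Context {R : realType}.
Variables (m s : R).
Hypothesis s0 : s != 0.
Local Notation mu := (@lebesgue_measure R).
Local Notation pdf := (normal_pdf m s).

Lemma cvg_normal_pdf_oppnat : pdf (- n%:R) @[n --> \oo] --> (0 : R).
Proof.
have -> : (fun n => pdf (- n%:R)) = (fun n => normal_pdf (- m) s n%:R).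
  apply/funext => n; rewrite !normal_pdfE// /normal_fun.
  by rewrite -opprD sqrrN opprK.
exact: cvg_normal_pdf_nat.
Qed.

Lemma measurable_comp_affine (a phi : R) (f : R -> R) : continuous f ->
  measurable_fun setT (fun x : R => f (a * (x - m) + phi)).
Proof.
move=> cf; apply: (measurableT_comp (continuous_measurable_fun cf)).
by apply: measurable_funD => //; apply: measurable_funM => //; exact: measurable_funB.
Qed.

Lemma derive_sin_normal_pdf_bound (a phi x : R) :
  `|a * cos (a * (x - m) + phi) - (x - m) / s ^+ 2 * sin (a * (x - m) + phi)| <=
  (`|a| + `|m| / s ^+ 2) + (s ^+ 2)^-1 * `|x|.
Proof.
have s2 : 0 <= (s ^+ 2)^-1 by rewrite invr_ge0 sqr_ge0.
rewrite (le_trans (ler_normB _ _))// -addrA lerD//.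
  by rewrite normrM ler_piMr// cos_max.
rewrite normrM (le_trans (ler_piMr _ (sin_max _)))//.
rewrite normrM (ger0_norm s2).
have -> : `|m| / s ^+ 2 + (s ^+ 2)^-1 * `|x| = (`|x| + `|m|) / s ^+ 2.
  by rewrite mulrDl addrC (mulrC _ `|x|).
by rewrite ler_wpM2r// ler_normB.
Qed.

(** The integrand is the derivative of [pdf x * sin (a * (x - m) + phi)], whose values at both ends
    tend to 0 with the density. *)
Lemma Rintegral_derive_sin_normal_pdf (a phi : R) :
  (\int[mu]_x (pdf x * (a * cos (a * (x - m) + phi) -
       (x - m) / s ^+ 2 * sin (a * (x - m) + phi))) = 0)%R.
Proof.
apply: (Rintegral_derive_eq0 (fun x => pdf x * sin (a * (x - m) + phi))).
- exact: is_derive_normal_pdf_sin.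
- move=> x; apply: differentiable_continuous; apply/derivable1_diffP.
  have h := is_derive_normal_pdf m s s0 x.
  exact: ex_derive.
- under eq_fun do rewrite mulrC.
  apply: (integrable_bounded_normal_pdf _ _ s0 _ _ _ _ (derive_sin_normal_pdf_bound a phi)).
  apply: measurable_funB; apply: measurable_funM => //.
  + by apply: measurable_comp_affine => x; exact: continuous_cos.
  + by apply: measurable_funM => //; exact: measurable_funB.
  + by apply: measurable_comp_affine => x; exact: continuous_sin.
- apply: (@squeeze_cvgr _ _ _ _ (fun n => - pdf n%:R) (fun n => pdf n%:R)).
  + near=> n; rewrite -ler_norml normrM ger0_norm ?normal_pdf_ge0//.
    by rewrite ler_piMr ?normal_pdf_ge0// sin_max.
  + by rewrite -oppr0; apply: cvgN; exact: cvg_normal_pdf_nat.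
  + exact: cvg_normal_pdf_nat.
- apply: (@squeeze_cvgr _ _ _ _ (fun n => - pdf (- n%:R)) (fun n => pdf (- n%:R))).
  + near=> n; rewrite -ler_norml normrM ger0_norm ?normal_pdf_ge0//.
    by rewrite ler_piMr ?normal_pdf_ge0// sin_max.
  + by rewrite -oppr0; apply: cvgN; exact: cvg_normal_pdf_oppnat.
  + exact: cvg_normal_pdf_oppnat.
Unshelve. all: end_near. Qed.

Let tilted_cos phi (a x : R) : R := expR ((a * s) ^+ 2 / 2) * (cos (a * (x - m) + phi) * pdf x).

(* The derivative in [a] is [s^2 expR ((a s)^2 / 2)] times the derivative in [x]
   of [pdf x * sin (a * (x - m) + phi)], so the integral over [x] does not
   depend on [a]. *)
Lemma is_derive_tilted_cos phi (a x : R) : is_derive a (1 : R) (tilted_cos phi ^~ x)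
  (expR ((a * s) ^+ 2 / 2) * s ^+ 2 *
   ((a * cos (a * (x - m) + phi) - (x - m) / s ^+ 2 * sin (a * (x - m) + phi)) * pdf x)).
Proof.
rewrite /tilted_cos.
apply: is_derive_eq; rewrite /GRing.scale /=.
by field.
Qed.

Lemma integrable_tilted_cos phi a : mu.-integrable setT (EFin \o tilted_cos phi a).
Proof.
rewrite /comp /tilted_cos.
under eq_fun do rewrite EFinM.
apply: integrableZl => //.
apply: (integrable_bounded_normal_pdf _ _ s0 _ 1 0).
  by apply: measurable_comp_affine => x; exact: continuous_cos.
by move=> x; rewrite (mul0r `|x|) addr0 cos_max.
Qed.

Lemma is_derive_Rintegral_tilted_cos phi (a : R) :
  is_derive a (1 : R) (fun a => \int[mu]_x tilted_cos phi a x)%R 0.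
Proof.
(* [M] bounds every parameter in the interval of radius 1 around [a], and [G] dominates the partial
   derivatives there. *)
pose M := `|a| + 1.
pose C := expR ((M * s) ^+ 2 / 2) * s ^+ 2.
pose A := (M + `|m| / s ^+ 2); pose B := (s ^+ 2)^-1.
pose G x := C * ((A + B * `|x|) * pdf x).
have Ia : `](a - 1), (a + 1)[%classic a by rewrite /= in_itv/= ltrBlDr ltrDl ltr01.
have d1E x y : partial1of2 (tilted_cos phi) x y = (expR ((x * s) ^+ 2 / 2) * s ^+ 2 *
   ((x * cos (x * (y - m) + phi) - (y - m) / s ^+ 2 * sin (x * (y - m) + phi)) * pdf y)).
  by rewrite partial1of2E; have h := is_derive_tilted_cos phi x y; rewrite derive_val.
have G0 y : 0 <= G y.
  have s2 : 0 <= (s ^+ 2)^-1 by rewrite invr_ge0 sqr_ge0.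
  have M0 : 0 <= M by rewrite /M addr_ge0.
  apply: mulr_ge0; first by apply: mulr_ge0; [exact: expR_ge0|exact: sqr_ge0].
  apply: mulr_ge0; last exact: normal_pdf_ge0.
  by apply: addr_ge0; [apply: addr_ge0 => //; exact: mulr_ge0|exact: mulr_ge0].
have iG : mu.-integrable setT (EFin \o G).
  rewrite /comp /G; under eq_fun do rewrite EFinM.
  by apply: integrableZl => //; exact: integrable_affine_normal_pdf.
have Gub x y : `](a - 1), (a + 1)[%classic x -> setT y -> `|partial1of2 (tilted_cos phi) x y| <= G y.
  rewrite /= in_itv/= => /andP[x1 x2] _.
  have xM : `|x| <= M.
    rewrite /M ler_norml; have := ler_norm a; have := ler_norm (- a); rewrite normrN.
    by move=> *; apply/andP; split; lra.
  have es t : 0 <= expR t * s ^+ 2 by apply: mulr_ge0; [exact: expR_ge0|exact: sqr_ge0].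
  rewrite d1E normrM (ger0_norm (es _)) /G /C; apply: ler_pM => //.
    rewrite ler_wpM2r ?sqr_ge0// ler_expR ler_wpM2r// !exprMn ler_wpM2r ?sqr_ge0//.
    by rewrite -(real_normK (num_real x)) ler_sqr ?nnegrE// /M addr_ge0.
  rewrite normrM (ger0_norm (normal_pdf_ge0 _ _ _)) ler_wpM2r ?normal_pdf_ge0//.
  by rewrite (le_trans (derive_sin_normal_pdf_bound _ _ _))// /A /B lerD2r lerD2r.
have der x y : `](a - 1), (a + 1)[%classic x -> setT y -> derivable (tilted_cos phi ^~ y) x 1.
  by move=> _ _; have h := is_derive_tilted_cos phi x y; exact: ex_derive.
have intg x : `](a - 1), (a + 1)[%classic x -> mu.-integrable setT (EFin \o tilted_cos phi x).
  by move=> _; exact: integrable_tilted_cos.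
apply: DeriveDef.
  exact: (derivable_under_integral measurableT Ia intg der G0 iG Gub).
rewrite -derive1E (differentiation_under_integral measurableT Ia intg der G0 iG Gub).
under eq_Rintegral do rewrite d1E.
rewrite RintegralZl//; last first.
  apply: (integrable_bounded_normal_pdf _ _ s0 _ _ _ _ (derive_sin_normal_pdf_bound a phi)).
  apply: measurable_funB; apply: measurable_funM => //.
  + by apply: measurable_comp_affine => x; exact: continuous_cos.
  + by apply: measurable_funM => //; exact: measurable_funB.
  + by apply: measurable_comp_affine => x; exact: continuous_sin.
under eq_Rintegral do rewrite mulrC.
by rewrite Rintegral_derive_sin_normal_pdf mulr0.
Qed.

(** The integral of [tilted_cos] does not depend on the frequency, and at frequency 0 its integrand
    is a constant times the density. *)
Lemma Rintegral_cos_normal_pdf (a phi : R) :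
  (\int[mu]_x (cos (a * x + phi) * pdf x))%R =
  expR (- ((a * s) ^+ 2 / 2)) * cos (a * m + phi).
Proof.
(* The phase [a * m + phi] undoes the centring: [a * (x - m) + (a * m + phi) = a * x + phi]. *)
have h := @is_derive_0_is_cst R _ a 0 (is_derive_Rintegral_tilted_cos (a * m + phi)).
have : (\int[mu]_x tilted_cos (a * m + phi) 0 x)%R = cos (a * m + phi).
  rewrite /tilted_cos RintegralZl//; last first.
    apply: (integrable_bounded_normal_pdf _ _ s0 _ 1 0).
      by apply: measurable_comp_affine => x; exact: continuous_cos.
    by move=> x; rewrite (mul0r `|x|) addr0 cos_max.
  rewrite mul0r expr0n mul0r expR0 mul1r.
  under eq_Rintegral do rewrite mul0r add0r.
  rewrite RintegralZl//; last exact: integrable_normal_pdf.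
  by rewrite /Rintegral integral_normal_pdf mulr1.
rewrite -h /tilted_cos RintegralZl//; last first.
  apply: (integrable_bounded_normal_pdf _ _ s0 _ 1 0).
    by apply: measurable_comp_affine => x; exact: continuous_cos.
  by move=> x; rewrite (mul0r `|x|) addr0 cos_max.
move=> <-; rewrite expRN mulrA mulVf ?gt_eqF ?expR_gt0// mul1r.
by apply: eq_Rintegral => x _; congr (cos _ * _); ring.
Qed.
End normal_cosine.

(** * Taylor estimates *)

Section elementary.
Context {R : realType}.
Implicit Types x y : R.

(** The Taylor bounds below form a ladder: each difference vanishes at 0 and has a nonnegative
    derivative, often by the bound shown before it. *)
Lemma derive_ge0_le (F f : R -> R) :
  (forall x, 0 <= x -> is_derive x (1 : R) F (f x)) ->
  (forall x, 0 <= x -> 0 <= f x) -> forall x, 0 <= x -> F 0 <= F x.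
Proof.
move=> dF f0 x x0.
have [||c] := @MVT_segment R F f 0 x x0.
- by move=> y; rewrite in_itv/= => /andP[/ltW y0 _]; exact: dF.
- apply: derivable_within_continuous => y; rewrite in_itv/= => /andP[y0 _].
  by have h := dF y y0; exact: ex_derive.
- rewrite in_itv/= => /andP[c0 _] h.
  by rewrite -subr_ge0 h mulr_ge0 ?f0// subr0.
Qed.

Lemma sin_le x : 0 <= x -> sin x <= x.
Proof.
move=> x0; pose F := (fun x : R => x - sin x); pose f := (fun x : R => 1 - cos x).
have dF y : 0 <= y -> is_derive y (1 : R) F (f y).
  by move=> _; rewrite /F /f; apply: is_derive_eq.
have f0 y : 0 <= y -> 0 <= f y.
  by move=> _; rewrite subr_ge0 cos_le1.
have := derive_ge0_le F f dF f0 x x0.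
by rewrite /F sin0 subr0 subr_ge0.
Qed.

Lemma cos_ge x : 0 <= x -> 0 <= cos x - 1 + x ^+ 2 / 2.
Proof.
move=> x0; pose F := (fun x : R => cos x - 1 + x ^+ 2 / 2); pose f := (fun x : R => x - sin x).
have dF y : 0 <= y -> is_derive y (1 : R) F (f y).
  by move=> _; rewrite /F /f; apply: is_derive_eq; rewrite /GRing.scale/=; field.
have f0 y : 0 <= y -> 0 <= f y.
  by move=> y0; rewrite subr_ge0 sin_le.
have := derive_ge0_le F f dF f0 x x0.
by rewrite /F cos0 expr0n mul0r subrr addr0.
Qed.

Lemma sin_ge3 x : 0 <= x -> 0 <= sin x - x + x ^+ 3 / 6.
Proof.
move=> x0; pose F := (fun x : R => sin x - x + x ^+ 3 / 6); pose f := (fun x : R => cos x - 1 + x ^+ 2 / 2).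
have dF y : 0 <= y -> is_derive y (1 : R) F (f y).
  by move=> _; rewrite /F /f; apply: is_derive_eq; rewrite /GRing.scale/=; field.
have f0 y : 0 <= y -> 0 <= f y.
  by move=> y0; exact: cos_ge.
have := derive_ge0_le F f dF f0 x x0.
by rewrite /F sin0 expr0n mul0r subrr addr0.
Qed.

Lemma cosD_ge x : 0 <= x -> 0 <= cos x - 1 + x.
Proof.
move=> x0; pose F := (fun x : R => cos x - 1 + x); pose f := (fun x : R => 1 - sin x).
have dF y : 0 <= y -> is_derive y (1 : R) F (f y).
  by move=> _; rewrite /F /f; apply: is_derive_eq; rewrite /GRing.scale/=; ring.
have f0 y : 0 <= y -> 0 <= f y.
  by move=> _; rewrite subr_ge0 sin_le1.
have := derive_ge0_le F f dF f0 x x0.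
by rewrite /F cos0 subrr addr0.
Qed.

Lemma sin_ge2 x : 0 <= x -> 0 <= sin x - x + x ^+ 2 / 2.
Proof.
move=> x0; pose F := (fun x : R => sin x - x + x ^+ 2 / 2); pose f := (fun x : R => cos x - 1 + x).
have dF y : 0 <= y -> is_derive y (1 : R) F (f y).
  by move=> _; rewrite /F /f; apply: is_derive_eq; rewrite /GRing.scale/=; field.
have f0 y : 0 <= y -> 0 <= f y.
  by move=> y0; exact: cosD_ge.
have := derive_ge0_le F f dF f0 x x0.
by rewrite /F sin0 expr0n mul0r subrr addr0.
Qed.

Lemma cos_le3 x : 0 <= x -> 0 <= x ^+ 3 / 6 - (cos x - 1 + x ^+ 2 / 2).
Proof.
move=> x0; pose F := (fun x : R => x ^+ 3 / 6 - (cos x - 1 + x ^+ 2 / 2)); pose f := (fun x : R => sin x - x + x ^+ 2 / 2).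
have dF y : 0 <= y -> is_derive y (1 : R) F (f y).
  by move=> _; rewrite /F /f; apply: is_derive_eq; rewrite /GRing.scale/=; field.
have f0 y : 0 <= y -> 0 <= f y.
  by move=> y0; exact: sin_ge2.
have := derive_ge0_le F f dF f0 x x0.
by rewrite /F cos0 !expr0n !mul0r subrr addr0 subr0.
Qed.

Lemma sin_sub_sqr x : `|sin x - x| <= x ^+ 2 / 2.
Proof.
wlog x0 : x / 0 <= x.
  move=> h; have [/h//|/ltW x0] := leP 0 x.
  by rewrite -sqrrN -normrN opprD -sinN h// oppr_ge0.
have h1 := sin_le x x0; have h2 := sin_ge2 x x0.
by rewrite ler_norml; apply/andP; split; nra.
Qed.

Lemma sin_sub_cube x : `|sin x - x| <= `|x| ^+ 3 / 6.
Proof.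
wlog x0 : x / 0 <= x.
  move=> h; have [/h//|/ltW x0] := leP 0 x.
  by rewrite -(normrN x) -(normrN (sin x - x)) opprD -sinN h// oppr_ge0.
have h1 := sin_le x x0; have h2 := sin_ge3 x x0.
rewrite (ger0_norm x0) ler_norml; have := exprn_ge0 3 x0.
by move=> h3; apply/andP; split; lra.
Qed.

Lemma cos_sub_cube x : `|cos x - 1 + x ^+ 2 / 2| <= `|x| ^+ 3 / 6.
Proof.
wlog x0 : x / 0 <= x.
  move=> h; have [/h//|/ltW x0] := leP 0 x.
  by rewrite -(normrN x) -sqrrN -cosN h// oppr_ge0.
have h1 := cos_ge x x0; have h2 := cos_le3 x x0.
by rewrite (ger0_norm x0) ger0_norm//; lra.
Qed.

(** The addition formula splits the remainder into those of [cos y] and [sin y], each at most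
    [|y| ^+ 3 / 6]; the constant 1 is a convenient loss. *)
Lemma cosD_taylor (t y : R) :
  `|cos (t + y) - cos t + y * sin t + y ^+ 2 / 2 * cos t| <= `|y| ^+ 3.
Proof.
have -> : cos (t + y) - cos t + y * sin t + y ^+ 2 / 2 * cos t =
  cos t * (cos y - 1 + y ^+ 2 / 2) - sin t * (sin y - y) by rewrite cosD; ring.
have h1 := cos_sub_cube y; have h2 := sin_sub_cube y.
have a1 : `|cos t * (cos y - 1 + y ^+ 2 / 2)| <= `|y| ^+ 3 / 6.
  by rewrite normrM (le_trans _ h1)// ler_piMl// cos_max.
have a2 : `|sin t * (sin y - y)| <= `|y| ^+ 3 / 6.
  by rewrite normrM (le_trans _ h2)// ler_piMl// sin_max.
rewrite (le_trans (ler_normB _ _))//.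
have : 0 <= `|y| ^+ 3 by exact: exprn_ge0.
lra.
Qed.

(** The two gaps vanish at 0 and have derivatives [x ^+ 2 / (1 + x)] and [x ^+ 3 / (1 + x)]. *)
Lemma ln1D_taylor x : 0 <= x -> 0 <= ln (1 + x) - x + x ^+ 2 / 2 <= x ^+ 3 / 3.
Proof.
move=> x0.
have dl y : 0 <= y -> is_derive y (1 : R) (fun y => ln (1 + y)) (1 + y)^-1.
  move=> y0; have h := @is_derive1_ln R (1 + y) _.
  have {}h : is_derive (1 + y) (1 : R) (@ln R) (1 + y)^-1 by apply: h; rewrite ltr_wpDr.
  apply: is_derive_eq; rewrite /GRing.scale/=; ring.
have a1 : 0 <= ln (1 + x) - x + x ^+ 2 / 2.
  pose F := (fun x : R => ln (1 + x) - x + x ^+ 2 / 2); pose f := (fun x : R => x ^+ 2 / (1 + x)).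
  have dF y : 0 <= y -> is_derive y (1 : R) F (f y).
    move=> y0; have h := dl y y0; rewrite /F /f; apply: is_derive_eq; rewrite /GRing.scale/=; field.
    by rewrite /= gt_eqF// ltr_wpDr.
  have f0 y : 0 <= y -> 0 <= f y.
    by move=> y0; rewrite divr_ge0 ?sqr_ge0// addr_ge0.
  have := derive_ge0_le F f dF f0 x x0.
  by rewrite /F addr0 ln1 expr0n mul0r subrr addr0.
have a2 : 0 <= x ^+ 3 / 3 - (ln (1 + x) - x + x ^+ 2 / 2).
  pose F := (fun x : R => x ^+ 3 / 3 - (ln (1 + x) - x + x ^+ 2 / 2)); pose f := (fun x : R => x ^+ 3 / (1 + x)).
  have dF y : 0 <= y -> is_derive y (1 : R) F (f y).
    move=> y0; have h := dl y y0; rewrite /F /f; apply: is_derive_eq; rewrite /GRing.scale/=; field.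
    by rewrite /= gt_eqF// ltr_wpDr.
  have f0 y : 0 <= y -> 0 <= f y.
    by move=> y0; rewrite divr_ge0 ?exprn_ge0// addr_ge0.
  have := derive_ge0_le F f dF f0 x x0.
  by rewrite /F addr0 ln1 !expr0n !mul0r subrr addr0 subr0.
by apply/andP; split=> //; lra.
Qed.

Lemma expRN_taylor x : 0 <= x -> `|expR (- x) - 1 + x| <= x ^+ 2 / 2.
Proof.
move=> x0.
have a0 y : 0 <= y -> 0 <= expR (- y) - 1 + y.
  by move=> _; have := expR_ge1Dx (- y); lra.
have a2 : 0 <= x ^+ 2 / 2 - (expR (- x) - 1 + x).
  pose F := (fun x : R => x ^+ 2 / 2 - (expR (- x) - 1 + x)); pose f := (fun x : R => expR (- x) - 1 + x).
  have dF y : 0 <= y -> is_derive y (1 : R) F (f y).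
    by move=> _; rewrite /F /f; apply: is_derive_eq; rewrite /GRing.scale/=; field.
  have f0 y : 0 <= y -> 0 <= f y.
    exact: a0.
  have := derive_ge0_le F f dF f0 x x0.
  by rewrite /F oppr0 expR0 !expr0n !mul0r subrr addr0 subr0.
by rewrite ger0_norm ?a0//; lra.
Qed.
End elementary.

(** * Approximation by trigonometric polynomials *)

Section bernstein.
Context {R : realType}.
Implicit Types (y : R) (g h : nat -> R).

(* The mean of [g] under the binomial law with parameters [N] and [y]. *)
Fixpoint bernstein y N g : R :=
  if N is N'.+1 then y * bernstein y N' (g \o S) + (1 - y) * bernstein y N' g
  else g 0%N.

Lemma bernsteinD y N g h :
  bernstein y N (fun i => g i + h i) = bernstein y N g + bernstein y N h.
Proof.
elim: N g h => [//|N IH] g h /=.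
have := IH (g \o S) (h \o S); rewrite /comp => ->; rewrite IH; ring.
Qed.

Lemma bernsteinZ y N c g :
  bernstein y N (fun i => c * g i) = c * bernstein y N g.
Proof.
elim: N g => [//|N IH] g /=.
have := IH (g \o S); rewrite /comp => ->; rewrite IH; ring.
Qed.

Lemma bernstein_cst y N c : bernstein y N (fun=> c) = c.
Proof. by elim: N => [//|N IH] /=; rewrite /comp IH; ring. Qed.

Lemma le_bernstein y N g h : 0 <= y <= 1 -> (forall i, g i <= h i) ->
  bernstein y N g <= bernstein y N h.
Proof.
move=> /andP[y0 y1]; elim: N g h => [|N IH] g h gh /=; first exact: gh.
by apply: lerD; apply: ler_wpM2l; rewrite ?subr_ge0//; apply: IH => i /=.
Qed.

(** The offset [b] makes the induction close, since a success replaces it by [1 + b]; the case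
    [b = - (N%:R * y)] is the binomial variance. *)
Lemma bernstein_sqr y N b :
  bernstein y N (fun i => (i%:R + b) ^+ 2) = (N%:R * y + b) ^+ 2 + N%:R * (y * (1 - y)).
Proof.
elim: N b => [|N IH] b /=; first by rewrite !mul0r addr0 add0r.
have -> : (fun i => (i%:R + b) ^+ 2) \o S = (fun i : nat => (i%:R + (1 + b)) ^+ 2).
  by apply/funext => i /=; rewrite -natr1; congr (_ ^+ 2); ring.
rewrite !IH -natr1; ring.
Qed.

Lemma bernstein_lipschitz y N g L eta : 0 <= y <= 1 -> (0 < N)%N -> 0 <= L -> 0 < eta ->
  forall v : R, (forall i, `|g i - v| <= L * `|i%:R / N%:R - y|) ->
  `|bernstein y N g - v| <= L * (eta + (eta * N%:R)^-1).
Proof.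
move=> /[dup] y01 /andP[y0 y1] N0 L0 e0 v gv.
have N0' : 0 < N%:R :> R by rewrite ltr0n.
(* The inequality [|d| <= eta + d ^+ 2 / eta] replaces the absolute deviation by a quadratic one,
   whose mean [bernstein_sqr] computes exactly. *)
pose q i : R := L * (eta + (eta * N%:R ^+ 2)^-1 * (i%:R + - (N%:R * y)) ^+ 2).
have gq i : `|g i - v| <= q i.
  rewrite (le_trans (gv i))// /q ler_wpM2l//.
  have -> : i%:R / N%:R - y = (i%:R + - (N%:R * y)) / N%:R by field; rewrite gt_eqF.
  set d : R := i%:R + - (N%:R * y).
  have -> : eta + (eta * N%:R ^+ 2)^-1 * d ^+ 2 = eta + `|d / N%:R| ^+ 2 / eta.
    by rewrite real_normK ?num_real//; field; rewrite !gt_eqF.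
  set w := `|_|; have w0 : 0 <= w by exact: normr_ge0.
  have -> : eta + w ^+ 2 / eta = w + ((eta - w / 2) ^+ 2 + 3 / 4 * w ^+ 2) / eta.
    by field; rewrite gt_eqF.
  rewrite lerDl divr_ge0 ?(ltW e0)// addr_ge0 ?sqr_ge0// mulr_ge0 ?sqr_ge0//.
have qE : bernstein y N q = L * (eta + (eta * N%:R)^-1 * (y * (1 - y))).
  rewrite /q bernsteinZ bernsteinD bernstein_cst bernsteinZ bernstein_sqr.
  by congr (L * _); field; rewrite !gt_eqF.
have qle : bernstein y N q <= L * (eta + (eta * N%:R)^-1).
  rewrite qE ler_wpM2l// lerD2l ler_piMr ?invr_ge0 ?mulr_ge0 ?(ltW e0)//.
  nra.
have h1 : bernstein y N g <= bernstein y N (fun i => v + q i).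
  by apply: le_bernstein => // i; have := gq i; rewrite ler_norml => /andP[]; lra.
have h2 : bernstein y N (fun i => v + -1 * q i) <= bernstein y N g.
  by apply: le_bernstein => // i; have := gq i; rewrite ler_norml => /andP[]; lra.
rewrite bernsteinD bernstein_cst in h1.
rewrite bernsteinD bernstein_cst bernsteinZ in h2.
by rewrite ler_norml; apply/andP; split; lra.
Qed.
End bernstein.

Section trig.
Context {R : realType}.

(** Trigonometric polynomials with arbitrary real frequencies. The phase provides sines and
    constants, so linear combinations of cosines suffice. *)
Inductive trig : (R -> R) -> Prop :=
| trig_cos a phi : trig (fun x => cos (a * x + phi))
| trig_lin c f g : trig f -> trig g -> trig (fun x => c * f x + g x).

Lemma trig_cst c : trig (fun=> c).
Proof.
have h := trig_lin (c - 1) _ _ (trig_cos 0 0) (trig_cos 0 0).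
by have <- : (fun x => (c - 1) * cos (0 * x + 0) + cos (0 * x + 0)) = (fun=> c);
  first by apply/funext => x; rewrite mul0r addr0 cos0; ring.
Qed.

Lemma trigZ c f : trig f -> trig (fun x => c * f x).
Proof.
move=> tf; have h := trig_lin c _ _ tf (trig_cst 0).
by have <- : (fun x => c * f x + 0) = (fun x => c * f x);
  first by apply/funext => x; rewrite addr0.
Qed.

Lemma trigD f g : trig f -> trig g -> trig (fun x => f x + g x).
Proof.
move=> tf tg; have h := trig_lin 1 _ _ tf tg.
by have <- : (fun x => 1 * f x + g x) = (fun x => f x + g x);
  first by apply/funext => x; rewrite mul1r.
Qed.

(** Product-to-sum formula on the generators, then linearity. *)
Lemma trig_cosM a phi f : trig f -> trig (fun x => cos (a * x + phi) * f x).
Proof.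
elim=> [b psi|c g h _ IH1 _ IH2].
  have -> : (fun x : R => cos (a * x + phi) * cos (b * x + psi)) =
    (fun x => 2^-1 * cos ((a + b) * x + (phi + psi)) + 2^-1 * cos ((a - b) * x + (phi - psi))).
    apply/funext => x.
    have -> : (a + b) * x + (phi + psi) = (a * x + phi) + (b * x + psi) by ring.
    have -> : (a - b) * x + (phi - psi) = (a * x + phi) - (b * x + psi) by ring.
    by move: (a * x + phi) (b * x + psi) => u v; rewrite cosD cosB; field.
  by apply: trigD; apply: trigZ; exact: trig_cos.
have -> : (fun x : R => cos (a * x + phi) * (c * g x + h x)) =
  (fun x => c * (cos (a * x + phi) * g x) + cos (a * x + phi) * h x).
  by apply/funext => x; ring.
exact: trig_lin.
Qed.

Lemma trig_bernstein th N g :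
  trig (fun x => bernstein ((1 + sin (th * x)) / 2) N g).
Proof.
elim: N g => [|N IH] g /=; first exact: trig_cst.
(* The sine is written as minus a cosine shifted by [pi / 2], whence the negative coefficient on the
   success term. *)
have -> : (fun x => (1 + sin (th * x)) / 2 * bernstein ((1 + sin (th * x)) / 2) N (g \o S) +
     (1 - (1 + sin (th * x)) / 2) * bernstein ((1 + sin (th * x)) / 2) N g) =
  (fun x => (2^-1 * bernstein ((1 + sin (th * x)) / 2) N (g \o S) +
    2^-1 * bernstein ((1 + sin (th * x)) / 2) N g) +
    cos (th * x + pi / 2) * ((- 2^-1) * bernstein ((1 + sin (th * x)) / 2) N (g \o S) +
    2^-1 * bernstein ((1 + sin (th * x)) / 2) N g)).
  by apply/funext => x; rewrite cosDpihalf; field.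
apply: trigD; first by apply: trigD; apply: trigZ; exact: IH.
by apply: trig_cosM; apply: trigD; apply: trigZ; exact: IH.
Qed.

(* [f x] is close to [f (sin (th * x) / th)] for small [th], and the latter is a
   Lipschitz function of [(1 + sin (th * x)) / 2], to which Bernstein
   approximation applies. *)
Lemma trig_approx (f : R -> R) (e : R) : 0 < e ->
  (forall x, `|f x| <= 1) -> (forall x y, `|f x - f y| <= `|x - y|) ->
  exists2 q, trig q & forall x, `|f x - q x| <= e + e * `|x|.
Proof.
move=> e0 f1 fL.
(* With [z] the value at [sin (th * x) / th], [|f x - z|] is at most both 2 and [th * x ^+ 2], so
   its square is at most [2 * th * x ^+ 2 = e ^+ 2 * x ^+ 2]. [L] is the Lipschitz constant in
   [(1 + sin (th * x)) / 2], and [eta], [N] make the Bernstein error at most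
   [L * (eta + eta) = e]. *)
pose th := e ^+ 2 / 2.
have th0 : 0 < th by rewrite divr_gt0 ?exprn_gt0.
pose L := 2 / th.
have L0 : 0 < L by rewrite divr_gt0.
pose eta := e / (2 * L).
have eta0 : 0 < eta by apply: divr_gt0 => //; exact: mulr_gt0.
pose N := (Num.truncn ((eta ^+ 2)^-1)).+1.
have NN : (eta ^+ 2)^-1 <= N%:R by rewrite ltW// truncnS_gt.
have N0 : 0 < N%:R :> R by rewrite ltr0n.
pose g (i : nat) := f ((2 * (i%:R / N%:R) - 1) / th).
exists (fun x => bernstein ((1 + sin (th * x)) / 2) N g); first exact: trig_bernstein.
move=> x; pose z := f (sin (th * x) / th).
have s1 : sin (th * x) <= 1 by exact: sin_le1.
have s2 : -1 <= sin (th * x) by exact: sin_geN1.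
have h1 : `|bernstein ((1 + sin (th * x)) / 2) N g - z| <= e.
  have h := @bernstein_lipschitz R ((1 + sin (th * x)) / 2) N g L eta _ isT (ltW L0) eta0 z _.
  apply: (le_trans (h _ _)).
  - by apply/andP; split; lra.
  - move=> i; rewrite /g /z (le_trans (fL _ _))//.
    have -> : (2 * (i%:R / N%:R) - 1) / th - sin (th * x) / th =
      L * (i%:R / N%:R - (1 + sin (th * x)) / 2).
      by rewrite /L; field; rewrite !gt_eqF.
    by rewrite normrM (gtr0_norm L0).
  - have : (eta * N%:R)^-1 <= eta.
      have eN0 : 0 < eta * N%:R by exact: mulr_gt0.
      rewrite -[leRHS]invrK lef_pV2 ?posrE ?invr_gt0//.
      have -> : eta^-1 = eta * (eta ^+ 2)^-1 by field; rewrite gt_eqF.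
      by rewrite ler_wpM2l// ltW.
    move=> h3; apply: (@le_trans _ _ (L * (eta + eta))).
      by rewrite ler_wpM2l ?(ltW L0)// lerD2l.
    by rewrite le_eqVlt; apply/orP; left; apply/eqP; rewrite /eta; field; rewrite gt_eqF.
have h2 : `|f x - z| <= e * `|x|.
  have a1 : `|f x - z| <= 2.
    by rewrite (le_trans (ler_normB _ _))//; have := f1 x; have := f1 (sin (th * x) / th); rewrite -/z; lra.
  have a2 : `|f x - z| <= th * x ^+ 2.
    rewrite (le_trans (fL _ _))//.
    have -> : x - sin (th * x) / th = - (sin (th * x) - th * x) / th by field; rewrite gt_eqF.
    rewrite normrM normrN (gtr0_norm (_ : 0 < th^-1)) ?invr_gt0//.
    rewrite ler_pdivrMr// (le_trans (sin_sub_sqr _))//.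
    have : 0 <= (th * x) ^+ 2 by exact: sqr_ge0.
    nra.
  rewrite -ler_sqr ?nnegrE ?mulr_ge0 ?(ltW e0)//.
  rewrite exprMn (real_normK (num_real x)).
  have -> : e ^+ 2 * x ^+ 2 = 2 * (th * x ^+ 2) by rewrite /th; field.
  by rewrite expr2 ler_pM.
rewrite (le_trans (ler_distD z _ _))// addrC lerD//.
by rewrite distrC.
Qed.
End trig.

(** * Weak convergence from cosines *)

Section mean.
Context {R : realType}.

(** Affine growth, rather than boundedness, admits [|x|], which weighs the approximation error in
    [trig_approx]. *)
Definition tame (f : R -> R) :=
  measurable_fun setT f /\ exists A B, forall x, `|f x| <= A + B * `|x|.

(** Normalized positive linear functionals: a common setting for the finite averages over draws and
    the normal integral. *)
Definition mean_functional (E : (R -> R) -> R) :=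
  [/\ forall c f g, tame f -> tame g -> E (fun x => c * f x + g x) = c * E f + E g,
      forall f g, tame f -> tame g -> (forall x, f x <= g x) -> E f <= E g
    & E (fun=> 1) = 1].

Lemma tame_bounded (f : R -> R) (A : R) : measurable_fun setT f -> (forall x, `|f x| <= A) -> tame f.
Proof. by move=> mf fA; split=> //; exists A, 0 => x; rewrite mul0r addr0. Qed.

Lemma tame_lin c f g : tame f -> tame g -> tame (fun x => c * f x + g x).
Proof.
move=> [mf [A [B fA]]] [mg [C [D gC]]]; split.
  by apply: measurable_funD => //; exact: measurable_funM.
exists (`|c| * A + C), (`|c| * B + D) => x.
rewrite (le_trans (ler_normD _ _))// normrM.
have := ler_wpM2l (normr_ge0 c) (fA x); have := gC x; lra.
Qed.

Lemma tame_norm : tame (fun x => `|x|).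
Proof.
by split; [exact: measurableT_comp | exists 0, 1 => x; rewrite normr_id add0r mul1r].
Qed.

Lemma tame_cst c : tame (fun=> c).
Proof. by apply: (tame_bounded _ `|c|). Qed.

Lemma tame_cos (a phi : R) : tame (fun x => cos (a * x + phi)).
Proof.
apply: (tame_bounded _ 1) => [|x]; last exact: cos_max.
by apply: (measurableT_comp (continuous_measurable_fun (@continuous_cos R)));
  apply: measurable_funD => //; exact: measurable_funM.
Qed.

Lemma tame_trig f : trig f -> tame f.
Proof. by elim=> [a phi|c g h _ tg _ th]; [exact: tame_cos | exact: tame_lin]. Qed.

Lemma mean_dist E f g e : mean_functional E -> tame f -> tame g ->
  (forall x, `|f x - g x| <= e + e * `|x|) ->
  `|E f - E g| <= e + e * E (fun x => `|x|).
Proof.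
move=> [Elin Ele E1] tf tg fg.
pose h (x : R) := e * `|x| + e * 1.
(* Linearity has the shape [c * f + g], so the constant [e] is split as [(e - 1) * 1 + 1]. *)
have Ee : E (fun=> e * 1) = e.
  have := Elin (e - 1) _ _ (tame_cst 1) (tame_cst 1).
  rewrite E1 => h1; have -> : (fun _ : R => e * 1) = (fun=> (e - 1) * 1 + 1).
    by apply/funext => x; ring.
  by rewrite h1; ring.
have th : tame h by apply: tame_lin; [exact: tame_norm | exact: tame_cst].
have Eh : E h = e * E (fun x => `|x|) + e.
  by rewrite /h Elin ?Ee//; [exact: tame_norm | exact: tame_cst].
have h1 : E f <= 1 * E g + E h.
  rewrite -Elin//; apply: Ele => //; first exact: tame_lin.
  by move=> x; have := fg x; rewrite /h ler_norml => /andP[]; lra.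
have h2 : E g <= 1 * E f + E h.
  rewrite -Elin//; apply: Ele => //; first exact: tame_lin.
  by move=> x; have := fg x; rewrite /h ler_norml => /andP[]; lra.
by rewrite ler_norml; apply/andP; split; lra.
Qed.

(** Replacing [f] by a trigonometric polynomial costs [d + d * |x|], which is small uniformly in [n]
    because the absolute first moments stay below [K]. On the polynomial, convergence follows from
    that on cosines by linearity. *)
Lemma mean_cvg (E : nat -> (R -> R) -> R) J K :
  (forall n, mean_functional (E n)) -> mean_functional J ->
  (forall n, E n (fun x => `|x|) <= K) ->
  (forall a phi, E n (fun x => cos (a * x + phi)) @[n --> \oo] -->
     J (fun x => cos (a * x + phi))) ->
  forall f, tame f -> (forall x, `|f x| <= 1) ->
    (forall x y, `|f x - f y| <= `|x - y|) ->
  E n f @[n --> \oo] --> J f.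
Proof.
move=> mE mJ EK Ecos f tf f1 fL.
have Etrig q : trig q -> E n q @[n --> \oo] --> J q.
  elim=> [a phi|c g h tg IHg th IHh]; first exact: Ecos.
  have -> : (fun n => E n (fun x => c * g x + h x)) = (fun n => c * E n g + E n h).
    by apply/funext => n; have [-> //] := mE n; exact: tame_trig.
  have -> : J (fun x => c * g x + h x) = c * J g + J h.
    by have [-> //] := mJ; exact: tame_trig.
  by apply: cvgD => //; apply: cvgMl_tmp.
(* Five errors add up: [d] and at most [d * |K|] for the approximation under [E n], [d] and at most
   [d] times the size of the first absolute moment under [J], and [d] for the convergence on [q]. *)
pose M := `|K| + `|J (fun x => `|x|)| + 3.
have M0 : 0 < M by apply: ltr_wpDl => //; exact: addr_ge0.
apply/cvgrPdist_le => e e0.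
pose d := e / M; have d0 : 0 < d by exact: divr_gt0.
have [q tq fq] := trig_approx f d d0 f1 fL.
have tq' := tame_trig q tq.
have /cvgrPdist_le/(_ d d0) := Etrig q tq.
apply: filterS => n Jq.
have h1 := mean_dist (E n) f q d (mE n) tf tq' fq.
have h2 := mean_dist J f q d mJ tf tq' fq.
have k1 : d * E n (fun x => `|x|) <= d * `|K|.
  by rewrite ler_wpM2l ?(ltW d0)// (le_trans (EK n))// ler_norm.
have k2 : d * J (fun x => `|x|) <= d * `|J (fun x => `|x|)|.
  by rewrite ler_wpM2l ?(ltW d0)// ler_norm.
have -> : e = d * `|K| + d * `|J (fun x => `|x|)| + 3 * d.
  by rewrite /d /M; field; rewrite gt_eqF.
move: h1 h2 Jq; rewrite !ler_norml => /andP[? ?] /andP[? ?] /andP[? ?].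
by apply/andP; split; lra.
Qed.

End mean.

(** * The normal integral as a mean functional, and the limit value *)

Section gauss_mean.
Context {R : realType}.
Variables (m s : R).
Hypothesis s0 : s != 0.
Local Notation mu := (@lebesgue_measure R).
Local Notation pdf := (normal_pdf m s).

Lemma tame_integrable (f : R -> R) : tame f ->
  mu.-integrable setT (fun x => (f x * pdf x)%:E).
Proof. by move=> [mf [A [B fA]]]; exact: integrable_bounded_normal_pdf fA. Qed.

Lemma mean_functional_normal :
  mean_functional (fun f => \int[mu]_x (f x * pdf x))%R.
Proof.
split=> [c f g tf tg|f g tf tg fg|].
- under eq_Rintegral do rewrite mulrDl -mulrA.
  rewrite RintegralD//.
  + by rewrite RintegralZl//; exact: tame_integrable.
  + rewrite /comp; under eq_fun do rewrite EFinM.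
    by apply: integrableZl => //; exact: tame_integrable.
  + exact: tame_integrable.
- apply: le_Rintegral => //; [exact: tame_integrable..|move=> x _].
  by rewrite ler_wpM2r ?normal_pdf_ge0.
- under eq_Rintegral do rewrite mul1r.
  by rewrite /Rintegral integral_normal_pdf.
Qed.

Lemma posexp_le1 (x : R) : `|Num.max 0 (1 - expR (- x))| <= 1.
Proof.
have h := expR_ge0 (- x).
by rewrite ger0_norm ?le_max ?lexx// ge_max ler01/=; lra.
Qed.

(** The slope of [expR (- x)] is at most 1 in size for [x >= 0], and the truncation removes negative
    arguments; both cases reduce to [1 + t <= expR t]. *)
Lemma posexp_lipschitz (x y : R) :
  `|Num.max 0 (1 - expR (- x)) - Num.max 0 (1 - expR (- y))| <= `|x - y|.
Proof.
wlog xy : x y / x <= y.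
  move=> h; have [/h//|/ltW/h] := leP x y.
  by rewrite distrC (distrC y).
have exy : expR (- y) <= expR (- x) by rewrite ler_expR lerN2.
have [x0|x0] := leP 0 x.
  have hx : expR (- x) <= 1 by rewrite -expR0 ler_expR lerNl oppr0.
  rewrite !max_r; [|lra..].
  have h := expR_ge1Dx (x - y).
  have hy : expR (- y) = expR (- x) * expR (x - y) by rewrite -expRD; congr expR; ring.
  have ex0 := expR_gt0 (- x).
  rewrite ler0_norm; last lra.
  rewrite ler0_norm; last lra.
  rewrite hy; nra.
rewrite max_l; last by rewrite subr_le0 -expR0 ler_expR; lra.
have -> : `|x - y| = y - x by rewrite ler0_norm ?subr_le0// opprB.
rewrite sub0r normrN.
have h := expR_ge1Dx (- y).
rewrite ger0_norm; last by rewrite le_max lexx.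
rewrite ge_max subr_ge0 xy/=; lra.
Qed.

Lemma tame_posexp : tame (fun x : R => Num.max 0 (1 - expR (- x))).
Proof.
apply: (tame_bounded _ 1); last exact: posexp_le1.
apply: measurable_maxr => //; apply: measurable_funB => //.
by apply: measurableT_comp => //; exact: measurableT_comp.
Qed.

(* [`|1 - y| = 2 (1 - y)^+ - 1 + y], and [m = s^2 / 2] makes the mean of [expR (- x)] equal to 1. *)
Lemma normal_tv_integral : m = s ^+ 2 / 2 ->
  ((2^-1)%:E * \int[normal_prob m s]_x (`|1 - expR (- x)|)%:E)%E =
  (\int[mu]_x (Num.max 0 (1 - expR (- x)) * pdf x))%R%:E.
Proof.
move=> ms.
have me : measurable_fun setT (fun x : R => expR (- x)).
  by apply: measurableT_comp => //; exact: measurableT_comp.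
rewrite integral_normal_prob; last 2 first.
- by apply: measurableT_comp => //; exact: measurable_funB.
- by move=> x; exact: normr_ge0.
have ie : mu.-integrable setT (fun x => (expR (- x) * pdf x)%:E).
  have := integrable_expR_normal_pdf m s s0 (-1).
  by under eq_fun do rewrite mulN1r.
have Ie : (\int[mu]_x (expR (- x) * pdf x))%R = 1.
  have := Rintegral_expR_normal_pdf m s s0 (-1).
  under eq_Rintegral do rewrite mulN1r.
  by move=> ->; rewrite ms -[RHS]expR0; congr expR; field.
have ip : mu.-integrable setT (fun x => (Num.max 0 (1 - expR (- x)) * pdf x)%:E).
  by apply: tame_integrable; exact: tame_posexp.
have i1 := integrable_normal_pdf m s.
pose h x := 2 * (Num.max 0 (1 - expR (- x)) * pdf x) - pdf x.
have ih2 : mu.-integrable setT (fun x => (2 * (Num.max 0 (1 - expR (- x)) * pdf x))%:E).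
  by under eq_fun do rewrite EFinM; apply: integrableZl.
have ih : mu.-integrable setT (fun x => (h x)%:E).
  by under eq_fun do rewrite /h EFinB; apply: integrableB.
have E x : `|1 - expR (- x)| * pdf x = h x + expR (- x) * pdf x.
  rewrite /h; have [h0|h0] := leP 0 (1 - expR (- x)).
    by rewrite ger0_norm//; ring.
  by rewrite ltr0_norm//; ring.
have iE : mu.-integrable setT (fun x => (h x + expR (- x) * pdf x)%:E).
  by under eq_fun do rewrite EFinD; apply: integrableD.
under eq_integral do rewrite E.
rewrite -(fineK (integrable_fin_num measurableT iE)) -EFinM; congr EFin.
rewrite -[fine _]/(\int[mu]_x (h x + expR (- x) * pdf x))%R RintegralD//.
rewrite Ie /h RintegralB// RintegralZl//.
have -> : (\int[mu]_x pdf x)%R = 1 by rewrite /Rintegral integral_normal_pdf.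
by field.
Qed.
End gauss_mean.

(** * Averages over sequences of draws *)

Section tv.
Context {R : realType}.

(** The supremum is attained at the set where [p <= q]. Equal total masses let a complement exchange
    the two signs of the difference. *)
Lemma dTV_posE (n k : nat) (p q : kmap n k -> R) :
  \sum_M p M = \sum_M q M ->
  dTV p q = \sum_M Num.max 0 (q M - p M).
Proof.
move=> pq.
have pos_le (u v : kmap n k -> R) (A : {set kmap n k}) :
    probA v A - probA u A <= \sum_M Num.max 0 (v M - u M).
  rewrite /probA -sumrB big_mkcond ler_sum// => M _.
  by case: ifP; rewrite le_max lexx ?orbT.
have compl (A : {set kmap n k}) : probA p A - probA q A = probA q (~: A) - probA p (~: A).
  have split_sum (u : kmap n k -> R) : \sum_M u M = probA u A + probA u (~: A).
    rewrite (bigID (mem A))/=; congr (_ + _).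
    by apply: eq_bigl => M; rewrite inE.
  by move: pq; rewrite !split_sum; lra.
apply/eqP; rewrite eq_le; apply/andP; split.
  apply: bigmax_le; first by apply: sumr_ge0 => M _; rewrite le_max lexx.
  move=> A _; rewrite ler_norml; apply/andP; split.
    by have := pos_le p q A; lra.
  by rewrite compl; exact: pos_le.
apply: (@le_trans _ _ (`|probA p [set M | p M <= q M] - probA q [set M | p M <= q M]|)).
  rewrite distrC (le_trans _ (ler_norm _))// /probA -sumrB [leRHS]big_mkcond.
  apply: ler_sum => M _; rewrite inE -[p M <= q M]subr_ge0.
  case: ifPn => h; rewrite ge_max lexx ?andbT//=.
  by rewrite -ltNge in h; exact: ltW.
exact: (@le_bigmax _ _ _ 0 (fun A => `|probA p A - probA q A|)).
Qed.
End tv.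

Section sequences.
Context {R : realType} {n : nat}.
Hypothesis n0 : (0 < n)%N.
Let nR0 : n%:R != 0 :> R. Proof. by rewrite pnatr_eq0 -lt0n. Qed.

Definition avg (g : 'I_n -> R) : R := (\sum_j g j) / n%:R.

(* The mean of [g] over uniform sequences of length [m], latest draw first. *)
Fixpoint seq_mean m (g : seq 'I_n -> R) : R :=
  if m is m'.+1 then seq_mean m' (fun s => avg (fun j => g (j :: s))) else g [::].

Lemma avgD g h : avg (fun j => g j + h j) = avg g + avg h.
Proof. by rewrite /avg big_split/= mulrDl. Qed.

Lemma avgZ c g : avg (fun j => c * g j) = c * avg g.
Proof. by rewrite /avg -mulr_sumr mulrA. Qed.

Lemma avg_cst c : avg (fun=> c) = c.
Proof. by rewrite /avg sumr_const card_ord -[c *+ n]mulr_natr mulfK. Qed.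

Lemma le_avg g h : (forall j, g j <= h j) -> avg g <= avg h.
Proof. by move=> gh; rewrite /avg ler_wpM2r// ler_sum. Qed.

Lemma avg_norm g : `|avg g| <= avg (fun j => `|g j|).
Proof.
by rewrite /avg normrM (ger0_norm (_ : 0 <= n%:R^-1))// ler_wpM2r// ler_norm_sum.
Qed.

Lemma eq_seq_mean m g h : (forall s, size s = m -> g s = h s) -> seq_mean m g = seq_mean m h.
Proof.
elim: m g h => [|m IH] g h gh /=; first exact: gh.
apply: IH => s sm; rewrite /avg; congr (_ / _).
by apply: eq_bigr => j _; apply: gh; rewrite /= sm.
Qed.

Lemma le_seq_mean m g h : (forall s, size s = m -> g s <= h s) ->
  seq_mean m g <= seq_mean m h.
Proof.
elim: m g h => [|m IH] g h gh /=; first exact: gh.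
by apply: IH => s sm; apply: le_avg => j; apply: gh; rewrite /= sm.
Qed.

Lemma seq_meanD m g h : seq_mean m (fun s => g s + h s) = seq_mean m g + seq_mean m h.
Proof.
elim: m g h => [//|m IH] g h /=.
by rewrite -IH; apply: eq_seq_mean => s _; rewrite avgD.
Qed.

Lemma seq_meanZ m c g : seq_mean m (fun s => c * g s) = c * seq_mean m g.
Proof.
elim: m g => [//|m IH] g /=.
by rewrite -IH; apply: eq_seq_mean => s _; rewrite avgZ.
Qed.

Lemma seq_mean_cst m c : seq_mean m (fun=> c) = c.
Proof.
elim: m => [//|m IH] /=; rewrite -[RHS]IH.
by apply: eq_seq_mean => s _; rewrite avg_cst.
Qed.

Lemma seq_mean_norm m g : `|seq_mean m g| <= seq_mean m (fun s => `|g s|).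
Proof.
elim: m g => [//|m IH] g /=.
by apply: (le_trans (IH _)); apply: le_seq_mean => s _; exact: avg_norm.
Qed.

Lemma seq_mean_tuple m g :
  seq_mean m g = (\sum_(t : m.-tuple 'I_n) g t) / n%:R ^+ m.
Proof.
elim: m g => [|m IH] g /=.
  rewrite expr0 divr1 (big_pred1 [tuple]) => [//|t]; by rewrite (tuple0 t); apply/esym/eqP.
rewrite IH exprSr invfM mulrA mulrAC; congr (_ / _).
rewrite /avg -mulr_suml; congr (_ / _).
rewrite pair_big/= [RHS](reindex (fun p : m.-tuple 'I_n * 'I_n => [tuple of p.2 :: p.1]))//=.
exists (fun t : m.+1.-tuple 'I_n => ([tuple of behead t], thead t)) => [[t j] _|t _] /=.
  by congr (_, _); apply: val_inj.
by rewrite [RHS]tuple_eta; apply: val_inj.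
Qed.

(** An enumeration of the pairs of a vertex and a label identifies maps with sequences of [k * n]
    draws. The hypothesis on [g] compares only counts with in-degrees, so the choice of enumeration
    does not matter. *)
Lemma sum_kmap_seq_mean k (g : seq 'I_n -> R) (G : kmap n k -> R) :
  (forall s M, (forall j, count_mem j s = indeg M j) -> size s = (k * n)%N -> g s = G M) ->
  \sum_M G M = n%:R ^+ (k * n) * seq_mean (k * n) g.
Proof.
move=> gG.
have cardT : #|{: 'I_n * 'I_k}| = (k * n)%N by rewrite card_prod !card_ord mulnC.
pose idx (p : 'I_n * 'I_k) : 'I_(k * n) := cast_ord cardT (enum_rank p).
pose xdi (i : 'I_(k * n)) : 'I_n * 'I_k := enum_val (cast_ord (esym cardT) i).
have idxK : cancel idx xdi by move=> p; rewrite /idx /xdi cast_ordK enum_rankK.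
have xdiK : cancel xdi idx by move=> i; rewrite /idx /xdi enum_valK cast_ordKV.
pose phi (t : (k * n).-tuple 'I_n) : kmap n k := [ffun i => [ffun l => tnth t (idx (i, l))]].
rewrite seq_mean_tuple mulrC divfK ?expf_neq0//.
rewrite (reindex phi)/=; last first.
  exists (fun M : kmap n k => [tuple M (xdi i).1 (xdi i).2 | i < k * n]) => [t _|M _].
    by apply: eq_from_tnth => i; rewrite tnth_mktuple !ffunE -surjective_pairing xdiK.
  by apply/ffunP => i; apply/ffunP => l; rewrite !ffunE tnth_mktuple idxK.
apply: eq_bigr => t _; apply/esym/gG; last by rewrite size_tuple.
move=> j; rewrite /indeg.
have -> : [set p : 'I_n * 'I_k | phi t p.1 p.2 == j]%SET = idx @^-1: [set i | tnth t i == j]%SET.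
  by apply/setP => -[i l]; rewrite !inE !ffunE.
rewrite on_card_preimset; last by exists xdi => ? _.
rewrite -{1}(map_tnth_enum t) count_map cardsE cardE /enum_mem size_filter -enumT.
by rewrite count_filter; apply: eq_count => i /=; rewrite andbT.
Qed.
End sequences.

(** * The likelihood ratio *)

Section likelihood.
Context {R : realType} {n : nat} (alpha : R).
Hypothesis n0 : (0 < n)%N.
Hypothesis alpha0 : 0 < alpha.
Let nR0 : 0 < n%:R :> R. Proof. by rewrite ltr0n. Qed.

Definition cnt (j : 'I_n) (s : seq 'I_n) : R := (count_mem j s)%:R.
Definition tau (s : seq 'I_n) : R := (size s)%:R / n%:R.

Lemma cnt_ge0 j s : 0 <= cnt j s. Proof. exact: ler0n. Qed.
Lemma tau_ge0 s : 0 <= tau s. Proof. by rewrite /tau divr_ge0. Qed.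

Lemma cnt_cons j i s : cnt j (i :: s) = cnt j s + (i == j)%:R.
Proof. by rewrite /cnt /= natrD addrC. Qed.

(** Only the urn just drawn changes its contents. *)
Lemma sum_cnt_cons (F : R -> R) i s :
  \sum_j F (cnt j (i :: s)) = \sum_j F (cnt j s) + (F (cnt i s + 1) - F (cnt i s)).
Proof.
rewrite (bigD1 i)//= [in RHS](bigD1 i)//= cnt_cons eqxx.
rewrite (eq_bigr (fun j => F (cnt j s))); last first.
  by move=> j ji; rewrite cnt_cons eq_sym (negbTE ji) addr0.
ring.
Qed.

Lemma sum_cnt s : \sum_j cnt j s = (size s)%:R.
Proof.
elim: s => [|i s IH]; first by rewrite big1// => j _; rewrite /cnt.
by rewrite (sum_cnt_cons id) IH/= -natr1; ring.
Qed.

Lemma avg_cnt s : avg (fun j => cnt j s) = tau s.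
Proof. by rewrite /avg sum_cnt. Qed.

(* Minus the logarithm of [palpha / punif], accumulated draw by draw. *)
Fixpoint neg_log_ratio (s : seq 'I_n) : R :=
  if s is j :: s' then
    neg_log_ratio s' + (ln (1 + tau s' / alpha) - ln (1 + cnt j s' / alpha))
  else 0.

Let pos1 (x : R) : 0 <= x -> 0 < 1 + x / alpha.
Proof. by move=> x0; rewrite ltr_pwDl// divr_ge0// ltW. Qed.

Lemma expR_neg_log_ratio_cons j s :
  expR (- neg_log_ratio (j :: s)) =
  expR (- neg_log_ratio s) * ((1 + cnt j s / alpha) / (1 + tau s / alpha)).
Proof.
rewrite /= opprD expRD; congr (_ * _).
by rewrite opprB expRD expRN !lnK ?posrE ?pos1 ?cnt_ge0 ?tau_ge0.
Qed.

Lemma rising_gt0 (x : R) m : 0 < x -> 0 < rising x m.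
Proof. by move=> x0; rewrite prodr_gt0// => i _; rewrite ltr_wpDr. Qed.

(** With [c] balls in urn [i] and [t] draws so far, drawing [i] multiplies the ratio by
    [n * (alpha + c) / (alpha * n + t)]: one more factor in the rising factorial of that urn and one
    in the denominator. *)
Lemma expR_neg_log_ratioE s : expR (- neg_log_ratio s) =
  (\prod_j rising alpha (count_mem j s)) * n%:R ^+ size s / rising (alpha * n%:R) (size s).
Proof.
elim: s => [|i s IH].
  rewrite /= oppr0 expR0 expr0 mulr1 /rising [X in _ / X]big_ord0 divr1 big1// => j _.
  by rewrite big_ord0.
rewrite expR_neg_log_ratio_cons IH (bigD1 i)//= [in RHS](bigD1 i)//= eqxx.
rewrite [in RHS](eq_bigr (fun j => rising alpha (count_mem j s))); last first.
  by move=> j ji; rewrite eq_sym (negbTE ji).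
rewrite add1n /rising !big_ord_recr/= exprS -/(cnt i s) /tau.
have r0 : rising (alpha * n%:R) (size s) != 0 by rewrite gt_eqF// rising_gt0// mulr_gt0.
rewrite /rising in r0; set P := \prod_(_ < size s) _ in r0 *.
have a1 : alpha * n%:R + (size s)%:R != 0 by rewrite gt_eqF// ltr_pwDl// mulr_gt0.
field.
by rewrite r0 a1 !gt_eqF.
Qed.

(** The urn contents average to [tau s], so the factor contributed by one draw averages to 1. *)
Lemma seq_mean_ratio m : seq_mean m (fun s => expR (- neg_log_ratio s)) = 1.
Proof.
elim: m => [|m IH] /=; first by rewrite oppr0 expR0.
rewrite -[RHS]IH; apply: eq_seq_mean => // s _.
transitivity (avg (fun j => expR (- neg_log_ratio s) / (1 + tau s / alpha) *
    (1 + alpha^-1 * cnt j s))).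
  rewrite /avg; congr (_ / _); apply: eq_bigr => j _.
  by rewrite -/neg_log_ratio -[_ + (_ - _)]/(neg_log_ratio (j :: s)) expR_neg_log_ratio_cons; ring.
rewrite avgZ// avgD// avg_cst// avgZ// avg_cnt.
by rewrite (mulrC alpha^-1) divfK// gt_eqF// pos1// tau_ge0.
Qed.

(** Both laws depend on a map only through its in-degrees, so sums over maps become means over
    draws. That [palpha] has total mass one is [seq_mean_ratio], and the uniform probability factors
    out of the positive part. *)
Lemma dTV_seq_mean k :
  dTV (@palpha R n k alpha) (@punif R n k) =
  seq_mean (k * n) (fun s => Num.max 0 (1 - expR (- neg_log_ratio s))).
Proof.
have nX : n%:R ^+ (k * n) != 0 :> R by rewrite expf_neq0// gt_eqF.
have palphaE (s : seq 'I_n) (M : kmap n k) : (forall j, count_mem j s = indeg M j) ->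
    size s = (k * n)%N -> palpha alpha M = punif R M * expR (- neg_log_ratio s).
  move=> sM ss; rewrite expR_neg_log_ratioE /palpha /punif ss.
  under [in RHS]eq_bigr do rewrite sM.
  by rewrite mulrCA !mulrA mulfK// mulrAC.
have sum1 : \sum_(M : kmap n k) punif R M = 1.
  rewrite (@sum_kmap_seq_mean R n n0 k (fun=> (n%:R ^+ (k * n))^-1))//.
  by rewrite seq_mean_cst// mulfV.
have sum2 : \sum_M @palpha R n k alpha M = 1.
  rewrite (@sum_kmap_seq_mean R n n0 k
    (fun s => (n%:R ^+ (k * n))^-1 * expR (- neg_log_ratio s))).
    by rewrite seq_meanZ// seq_mean_ratio mulr1 mulfV.
  by move=> s M sM ss; rewrite (palphaE s).
rewrite dTV_posE ?sum1 ?sum2//.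
rewrite (@sum_kmap_seq_mean R n n0 k
  (fun s => (n%:R ^+ (k * n))^-1 * Num.max 0 (1 - expR (- neg_log_ratio s)))).
  by rewrite seq_meanZ// mulrA mulfV// mul1r.
move=> s M sM ss; rewrite (palphaE s M sM ss) /punif maxr_pMr.
  by rewrite mulr0 mulrBr mulr1.
by rewrite invr_ge0 exprn_ge0.
Qed.
End likelihood.

(** * One draw *)

Section step.
Context {R : realType}.
Implicit Types (x w t a eps c u : R).

Lemma ln1D_bounds x : 0 <= x -> x - x ^+ 2 / 2 <= ln (1 + x) <= x.
Proof.
move=> x0; have /andP[h _] := ln1D_taylor x x0.
apply/andP; split; first by lra.
rewrite -ler_expR lnK ?posrE; first exact: expR_ge1Dx.
by rewrite ltr_pwDl.
Qed.

Lemma ln1D_ge0 x : 0 <= x -> 0 <= ln (1 + x).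
Proof. by move=> x0; rewrite ln_ge0// lerDl. Qed.

Lemma cube_ge0 x : 0 <= x -> 0 <= x ^+ 3. Proof. exact: exprn_ge0. Qed.

(** For the squares, [xi ^+ 2 - (w - x) ^+ 2] is factored; the bounds on the two factors multiply to
    [(x ^+ 2 + w ^+ 2) * (x + w)], which falls short of [2 * (x ^+ 3 + w ^+ 3)] by
    [(x - w) ^+ 2 * (x + w)]. *)
Lemma ln_diff_taylor x w : 0 <= x -> 0 <= w ->
  let xi := ln (1 + w) - ln (1 + x) in
  [/\ `|xi - (w - x + (x ^+ 2 - w ^+ 2) / 2)| <= x ^+ 3 + w ^+ 3,
      `|xi ^+ 2 - (w - x) ^+ 2| <= 2 * (x ^+ 3 + w ^+ 3) & `|xi| <= x + w].
Proof.
move=> x0 w0 xi.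
have /andP[tx1 tx2] := ln1D_taylor x x0; have /andP[tw1 tw2] := ln1D_taylor w w0.
have /andP[bx1 bx2] := ln1D_bounds x x0; have /andP[bw1 bw2] := ln1D_bounds w w0.
have px := ln1D_ge0 x x0; have pw := ln1D_ge0 w w0.
have x3 := cube_ge0 x x0; have w3 := cube_ge0 w w0.
have xi1 : `|xi| <= x + w by rewrite /xi ler_norml; apply/andP; split; lra.
split=> //.
  by rewrite /xi ler_norml; apply/andP; split; lra.
rewrite subr_sqr normrM.
have h1 : `|xi - (w - x)| <= (x ^+ 2 + w ^+ 2) / 2.
  by rewrite /xi ler_norml; apply/andP; split; lra.
have h2 : `|xi + (w - x)| <= 2 * (x + w).
  rewrite (le_trans (ler_normD _ _))//.
  have : `|w - x| <= x + w by rewrite ler_norml; apply/andP; split; lra.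
  lra.
apply: (le_trans (ler_pM (normr_ge0 _) (normr_ge0 _) h1 h2)).
have h3 : 0 <= (x - w) ^+ 2 * (x + w) by rewrite mulr_ge0 ?sqr_ge0 ?addr_ge0.
rewrite -subr_ge0; apply: (le_trans h3).
by rewrite le_eqVlt; apply/orP; left; apply/eqP; field.
Qed.

Lemma cube_sum_le (x y : R) : 0 <= x -> 0 <= y -> (x + y) ^+ 3 <= 4 * (x ^+ 3 + y ^+ 3).
Proof.
move=> x0 y0.
have h3 : 0 <= 3 * ((x - y) ^+ 2 * (x + y)).
  by apply: mulr_ge0 => //; apply: mulr_ge0; [exact: sqr_ge0|exact: addr_ge0].
rewrite -subr_ge0; apply: (le_trans h3).
by rewrite le_eqVlt; apply/orP; left; apply/eqP; ring.
Qed.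

(** Explicit but crude; what matters is that it depends on neither [eps] nor the urn contents. *)
Definition step_const (a kappa : R) : R :=
  (`|a| + a ^+ 2 + 32 * `|a| ^+ 3) * (1 + kappa ^+ 3) + a ^+ 2 * (kappa + kappa ^+ 2).

(** Second-order expansion of the cosine in the phase change of one draw, which is of order [eps].
    Here [eps] stands for [1 / alpha], [c] for the contents of the drawn urn, [u] for the mean
    contents, and [eps ^+ 2 * u / 2] is the drift being subtracted. *)
Lemma step_pointwise th a eps c u kappa :
  0 <= c -> 0 <= u <= kappa -> 0 < eps <= 1 ->
  `|cos (th + a * (ln (1 + u * eps) - ln (1 + c * eps) - eps ^+ 2 * u / 2)) -
    (cos th
     - sin th * (a * (eps * (u - c) + eps ^+ 2 * (c ^+ 2 - u ^+ 2) / 2 - eps ^+ 2 * u / 2))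
     - cos th / 2 * (a ^+ 2 * (eps ^+ 2 * (u - c) ^+ 2)))|
  <= step_const a kappa * (eps ^+ 3 * (1 + c ^+ 3)).
Proof.
move=> c0 /andP[u0 uk] /andP[e0 e1].
have k0 : 0 <= kappa by exact: le_trans uk.
have x0 : 0 <= c * eps by rewrite mulr_ge0// ltW.
have w0 : 0 <= u * eps by rewrite mulr_ge0// ltW.
have [r1 r2 r3] := ln_diff_taylor _ _ x0 w0.
set xi := ln _ - ln _ in r1 r2 r3 *.
set v := eps ^+ 2 * u.
set y := a * (xi - v / 2).
have e3 : 0 <= eps ^+ 3 by apply: exprn_ge0; exact: ltW.
have v0 : 0 <= v by rewrite mulr_ge0// sqr_ge0.
have vw : v <= u * eps.
  by rewrite /v expr2 -mulrA [u * eps]mulrC ler_piMl// mulr_ge0// ltW.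
have c3 := cube_ge0 c c0; have u3 := cube_ge0 u u0.
have u3k : u ^+ 3 <= kappa ^+ 3 by apply: lerXn2r; rewrite ?nnegrE.
have u2k : u ^+ 2 <= kappa ^+ 2 by apply: lerXn2r; rewrite ?nnegrE.
set S := c ^+ 3 + kappa ^+ 3.
have S0 : 0 <= S by rewrite addr_ge0// cube_ge0.
have xwS : (c * eps) ^+ 3 + (u * eps) ^+ 3 <= eps ^+ 3 * S.
  by rewrite !exprMn -mulrDl mulrC ler_wpM2l// lerD2l.
have a0 := normr_ge0 a; have a3 : 0 <= `|a| ^+ 3 by exact: exprn_ge0.
have a2 : 0 <= a ^+ 2 by exact: sqr_ge0.
have Ty := cosD_taylor th y.
(* [y1], [y2] and [y3] control the first-order term, the second-order term and the Taylor remainder,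
   each to order [eps ^+ 3]. *)
have y1 : `|y - a * (eps * (u - c) + eps ^+ 2 * (c ^+ 2 - u ^+ 2) / 2 - v / 2)| <= `|a| * (eps ^+ 3 * S).
  have -> : y - a * (eps * (u - c) + eps ^+ 2 * (c ^+ 2 - u ^+ 2) / 2 - v / 2) =
    a * (xi - (u * eps - c * eps + ((c * eps) ^+ 2 - (u * eps) ^+ 2) / 2)).
    by rewrite /y; field.
  by rewrite normrM ler_wpM2l// (le_trans r1).
have vx : v * `|xi| + v ^+ 2 <= eps ^+ 3 * (kappa * (1 + c ^+ 3) + 2 * kappa ^+ 2).
  apply: (@le_trans _ _ (v * (c * eps + u * eps) + v * (u * eps))).
    by rewrite lerD// ?expr2 ler_wpM2l.
  have -> : v * (c * eps + u * eps) + v * (u * eps) = eps ^+ 3 * (u * c + 2 * u ^+ 2).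
    by rewrite /v; ring.
  rewrite ler_wpM2l// lerD ?ler_wpM2l//.
  apply: ler_pM => //.
  have [cl|cl] := leP c 1; first by lra.
  have : c <= c ^+ 3 by rewrite ler_eXnr// ltW.
  lra.
have y2 : `|y ^+ 2 - a ^+ 2 * (eps ^+ 2 * (u - c) ^+ 2)| <=
   a ^+ 2 * (2 * (eps ^+ 3 * S) + eps ^+ 3 * (kappa * (1 + c ^+ 3) + 2 * kappa ^+ 2)).
  have -> : y ^+ 2 - a ^+ 2 * (eps ^+ 2 * (u - c) ^+ 2) =
    a ^+ 2 * ((xi ^+ 2 - (u * eps - c * eps) ^+ 2) + (- (v * xi) + v ^+ 2 / 4)).
    by rewrite /y; field.
  rewrite normrM (ger0_norm a2) ler_wpM2l// (le_trans (ler_normD _ _))// lerD//.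
    by apply: (le_trans r2); rewrite ler_wpM2l.
  apply: le_trans vx; rewrite (le_trans (ler_normD _ _))// normrN normrM (ger0_norm v0) lerD2l.
  have : 0 <= v ^+ 2 by exact: sqr_ge0.
  by move=> v2; rewrite ger0_norm; lra.
have y3 : `|y| ^+ 3 <= `|a| ^+ 3 * (32 * (eps ^+ 3 * S)).
  rewrite /y normrM exprMn ler_wpM2l//.
  apply: (@le_trans _ _ ((c * eps + 2 * (u * eps)) ^+ 3)).
    apply: lerXn2r; rewrite ?nnegrE//; first by rewrite addr_ge0// mulr_ge0.
    rewrite (le_trans (ler_normB _ _))//.
    rewrite (ger0_norm (_ : 0 <= v / 2)); last by rewrite divr_ge0.
    lra.
  apply: (le_trans (cube_sum_le _ _ _ _)) => //; first by rewrite mulr_ge0.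
  have := cube_ge0 _ x0; have := cube_ge0 _ w0.
  have -> : (2 * (u * eps)) ^+ 3 = 8 * (u * eps) ^+ 3 by ring.
  lra.
have -> : cos (th + y) - (cos th
     - sin th * (a * (eps * (u - c) + eps ^+ 2 * (c ^+ 2 - u ^+ 2) / 2 - v / 2))
     - cos th / 2 * (a ^+ 2 * (eps ^+ 2 * (u - c) ^+ 2))) =
  (cos (th + y) - cos th + y * sin th + y ^+ 2 / 2 * cos th)
  - sin th * (y - a * (eps * (u - c) + eps ^+ 2 * (c ^+ 2 - u ^+ 2) / 2 - v / 2))
  - cos th / 2 * (y ^+ 2 - a ^+ 2 * (eps ^+ 2 * (u - c) ^+ 2)) by field.
have z1 : `|sin th * (y - a * (eps * (u - c) + eps ^+ 2 * (c ^+ 2 - u ^+ 2) / 2 - v / 2))|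
    <= `|a| * (eps ^+ 3 * S).
  by rewrite normrM (le_trans _ y1)// ler_piMl// sin_max.
have z2 : `|cos th / 2 * (y ^+ 2 - a ^+ 2 * (eps ^+ 2 * (u - c) ^+ 2))| <=
   2^-1 * (a ^+ 2 * (2 * (eps ^+ 3 * S) + eps ^+ 3 * (kappa * (1 + c ^+ 3) + 2 * kappa ^+ 2))).
  rewrite normrM; apply: ler_pM => //.
  by rewrite normrM (ger0_norm (_ : 0 <= 2^-1))// ler_piMl// cos_max.
rewrite (le_trans (ler_normB _ _))//.
apply: (le_trans (lerD (le_trans (ler_normB _ _) (lerD (le_trans Ty y3) z1)) z2)).
have SS : S <= (1 + kappa ^+ 3) * (1 + c ^+ 3).
  rewrite /S; have := mulr_ge0 (cube_ge0 _ k0) c3; lra.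
have kk : kappa * (1 + c ^+ 3) + 2 * kappa ^+ 2 <= 2 * ((kappa + kappa ^+ 2) * (1 + c ^+ 3)).
  have := mulr_ge0 k0 c3; have := mulr_ge0 (sqr_ge0 kappa) c3; have := sqr_ge0 kappa; lra.
apply: (@le_trans _ _ ((`|a| + a ^+ 2 + 32 * `|a| ^+ 3) * (eps ^+ 3 * ((1 + kappa ^+ 3) * (1 + c ^+ 3))) +
   2^-1 * (a ^+ 2 * (eps ^+ 3 * (2 * ((kappa + kappa ^+ 2) * (1 + c ^+ 3))))))).
  have b1 := ler_wpM2l e3 SS; have b2 := ler_wpM2l e3 kk.
  have d1 := ler_wpM2l a0 b1; have d2 := ler_wpM2l a2 b1; have d3 := ler_wpM2l a3 b1.
  have d4 := ler_wpM2l a2 b2.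
  lra.
by rewrite le_eqVlt; apply/orP; left; apply/eqP; rewrite /step_const; field.
Qed.

End step.

Section step_avg.
Context {R : realType}.
Implicit Types (x w t a eps c u : R).

(** If the contents had second moment [u ^+ 2 + u], as for a Poisson law of mean [u], the averaged
    sine term would vanish and the cosine would be multiplied by [1 - a ^+ 2 * v / 2]. The absolute
    value in the bound measures the departure from that relation. *)
Lemma step_avg (n : nat) (c : 'I_n -> R) th a eps kappa u v : (0 < n)%N ->
  (forall j, 0 <= c j) -> avg c <= kappa -> 0 < eps <= 1 ->
  u = avg c -> v = eps ^+ 2 * u ->
  `|avg (fun j => cos (th + a * (ln (1 + u * eps) - ln (1 + c j * eps) - v / 2)))
    - expR (- (a ^+ 2 * v / 2)) * cos th| <=
  (step_const a kappa + a ^+ 4 * kappa ^+ 2) *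
    (eps ^+ 2 * `|avg (fun j => c j ^+ 2) - u ^+ 2 - u| +
     eps ^+ 3 * (1 + avg (fun j => c j ^+ 3))).
Proof.
move=> n0 c0 uk /[dup] e01 /andP[e0 e1] uE vE; rewrite -uE in uk.
have u0 : 0 <= u.
  by rewrite uE -(avg_cst n0 (0 : R)); apply: le_avg.
have k0 : 0 <= kappa by exact: le_trans uk.
have u0k : 0 <= u <= kappa by rewrite u0.
set f := fun j => cos (th + _).
(* The Taylor polynomial is regrouped by powers of [c j], so that its average involves only the
   first two moments. *)
pose p2 := - sin th * (a * eps ^+ 2 / 2) - cos th / 2 * (a ^+ 2 * eps ^+ 2).
pose p1 := sin th * (a * eps) + cos th * (a ^+ 2 * eps ^+ 2 * u).
pose p0 := cos th - sin th * (a * (eps * u - eps ^+ 2 * u ^+ 2 / 2 - v / 2))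
   - cos th / 2 * (a ^+ 2 * eps ^+ 2 * u ^+ 2).
pose M j := p0 + (p1 * c j + p2 * c j ^+ 2).
have fM j : `|f j + -1 * M j| <= step_const a kappa * (eps ^+ 3 * (1 + c j ^+ 3)).
  have := step_pointwise th a eps (c j) u kappa (c0 j) u0k e01; rewrite -vE.
  congr (`| _ | <= _); rewrite /f /M mulN1r; congr (_ - _).
  by rewrite /p0 /p1 /p2 vE; field.
have avgM : avg M = p0 + (p1 * u + p2 * avg (fun j => c j ^+ 2)).
  by rewrite /M avgD avg_cst// avgD !avgZ -uE.
have h1 : `|avg f + -1 * avg M| <=
    step_const a kappa * (eps ^+ 3 * (1 + avg (fun j => c j ^+ 3))).
  rewrite -avgZ -avgD (le_trans (avg_norm _))//.
  apply: (le_trans (le_avg _ _ fM)).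
  by rewrite avgZ avgZ avgD avg_cst.
set q := avg (fun j => c j ^+ 2) in avgM *.
set K3 := avg (fun j => c j ^+ 3) in h1 *.
have K30 : 0 <= K3.
  by rewrite -(avg_cst n0 (0 : R)); apply: le_avg => j; exact: cube_ge0.
have v0 : 0 <= v by rewrite vE; apply: mulr_ge0 => //; exact: sqr_ge0.
have z0 : 0 <= a ^+ 2 * v / 2.
  by apply: mulr_ge0 => //; apply: mulr_ge0 => //; exact: sqr_ge0.
have h2 := expRN_taylor _ z0; set r := expR _ - 1 + _ in h2.
have e3 : 0 <= eps ^+ 3 by apply: exprn_ge0; exact: ltW.
have a40 : 0 <= a ^+ 4 by rewrite (exprM a 2 2) sqr_ge0.
have h3 : `|r| <= a ^+ 4 * kappa ^+ 2 * (eps ^+ 3 * (1 + K3)).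
  apply: (le_trans h2).
  have u2k : u ^+ 2 <= kappa ^+ 2 by apply: lerXn2r; rewrite ?nnegrE.
  (* The remainder of the exponential is of order [eps ^+ 4]; one factor [eps <= 1] is given up. *)
  have -> : (a ^+ 2 * v / 2) ^+ 2 / 2 = a ^+ 4 * u ^+ 2 * (eps ^+ 3 * (eps / 8)).
    by rewrite vE; field.
  have e8 : 0 <= eps / 8 by rewrite divr_ge0// ltW.
  apply: ler_pM.
  - by apply: mulr_ge0 => //; exact: sqr_ge0.
  - exact: mulr_ge0.
  - exact: ler_wpM2l.
  - by apply: ler_wpM2l => //; lra.
have mid : avg M - expR (- (a ^+ 2 * v / 2)) * cos th =
  - ((sin th * a / 2 + cos th * a ^+ 2 / 2) * (eps ^+ 2 * (q - u ^+ 2 - u))) - cos th * r.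
  by rewrite avgM /r /p0 /p1 /p2 vE; field.
have h4 : `|cos th * r| <= a ^+ 4 * kappa ^+ 2 * (eps ^+ 3 * (1 + K3)).
  by rewrite normrM (le_trans _ h3)// ler_piMl// cos_max.
set D := `|q - u ^+ 2 - u|.
have D0 : 0 <= D by exact: normr_ge0.
have h5 : `|(sin th * a / 2 + cos th * a ^+ 2 / 2) * (eps ^+ 2 * (q - u ^+ 2 - u))| <=
    (`|a| + a ^+ 2) * (eps ^+ 2 * D).
  rewrite normrM [`|eps ^+ 2 * _|]normrM (ger0_norm (sqr_ge0 eps)) ler_wpM2r//.
    by rewrite mulr_ge0// sqr_ge0.
  rewrite (le_trans (ler_normD _ _))//.
  have s1 : `|sin th * a / 2| <= `|a| / 2.
    by rewrite normrM (ger0_norm (_ : 0 <= 2^-1))// ler_wpM2r// normrM ler_piMl// sin_max.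
  have s2 : `|cos th * a ^+ 2 / 2| <= a ^+ 2 / 2.
    rewrite normrM (ger0_norm (_ : 0 <= 2^-1))// ler_wpM2r// normrM.
    by rewrite (ger0_norm (sqr_ge0 a)) ler_piMl ?sqr_ge0// cos_max.
  by have := normr_ge0 a; have := sqr_ge0 a; lra.
have -> : avg f - expR (- (a ^+ 2 * v / 2)) * cos th =
  (avg f + -1 * avg M) + (avg M - expR (- (a ^+ 2 * v / 2)) * cos th) by ring.
rewrite (le_trans (ler_normD _ _))//.
rewrite mid.
have h6 := ler_normB (- ((sin th * a / 2 + cos th * a ^+ 2 / 2) * (eps ^+ 2 * (q - u ^+ 2 - u)))) (cos th * r).
rewrite normrN in h6.
have sc : `|a| + a ^+ 2 <= step_const a kappa + a ^+ 4 * kappa ^+ 2.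
  rewrite /step_const.
  have k3 := cube_ge0 _ k0; have a1 := normr_ge0 a; have a3 := cube_ge0 _ a1.
  have a2 := sqr_ge0 a; have k2 := sqr_ge0 kappa.
  have := mulr_ge0 a1 k3; have := mulr_ge0 a2 k3; have := mulr_ge0 a3 k3.
  have := mulr_ge0 a2 k0; have := mulr_ge0 a2 k2; have := mulr_ge0 a40 k2; lra.
have eD : 0 <= eps ^+ 2 * D by rewrite mulr_ge0// sqr_ge0.
have := ler_wpM2r eD sc.
lra.
Qed.
End step_avg.

(** * Moments of the urn contents *)

Section moments.
Context {R : realType} {n : nat}.
Hypothesis n0 : (0 < n)%N.
Variable k : nat.
Let nR0 : 0 < n%:R :> R. Proof. by rewrite ltr0n. Qed.
Local Notation cnt := (@cnt R n).
Local Notation tau := (@tau R n).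
Local Notation kappa := (k%:R : R).

(* Twice the number of collisions, minus its mean. *)
Definition collision_dev (s : seq 'I_n) : R :=
  \sum_j cnt j s ^+ 2 - (size s)%:R - (size s)%:R * ((size s)%:R - 1) / n%:R.

(** The increment is centred, since the contents average to [tau s]; hence the martingale
    property. *)
Lemma collision_dev_cons i s :
  collision_dev (i :: s) = collision_dev s + 2 * (cnt i s - tau s).
Proof.
rewrite /collision_dev (sum_cnt_cons (fun x => x ^+ 2)) /= -natr1 /tau.
by field; rewrite gt_eqF.
Qed.

Lemma avg_cnt_sqr s : avg (fun j => cnt j s ^+ 2) =
  collision_dev s / n%:R + tau s + tau s ^+ 2 - tau s / n%:R.
Proof. by rewrite /avg /collision_dev /tau; field; rewrite gt_eqF. Qed.

Lemma seq_mean_collision_dev m : seq_mean m collision_dev = 0.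
Proof.
elim: m => [|m IH].
  rewrite /= /collision_dev big1 /= ?mul0r ?subr0// => j _.
  by rewrite /cnt expr0n.
rewrite /= -[RHS]IH; apply: eq_seq_mean => // s _.
have -> : (fun j => collision_dev (j :: s)) = (fun j => collision_dev s + 2 * (cnt j s - tau s)).
  by apply/funext => j; exact: collision_dev_cons.
rewrite avgD avg_cst// avgZ.
have -> : avg (fun j => cnt j s - tau s) = 0; last by rewrite mulr0 addr0.
by rewrite (avgD _ (fun=> - tau s)) avg_cnt// avg_cst// subrr.
Qed.

Lemma tau_le s : (size s <= k * n)%N -> tau s <= kappa.
Proof. by move=> sk; rewrite /tau ler_pdivrMr// -natrM ler_nat. Qed.

Lemma avg_cnt_sqr_le s : (size s <= k * n)%N ->
  avg (fun j => cnt j s ^+ 2) <= n%:R^-1 * collision_dev s + (kappa + kappa ^+ 2).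
Proof.
move=> sk; rewrite avg_cnt_sqr.
have t0 : 0 <= tau s by exact: tau_ge0.
have tk := tau_le s sk.
have t2 : tau s ^+ 2 <= kappa ^+ 2 by apply: lerXn2r; rewrite ?nnegrE.
have : 0 <= tau s / n%:R by rewrite divr_ge0.
lra.
Qed.

Lemma seq_mean_cnt_sqr_le m : (m <= k * n)%N ->
  seq_mean m (fun s => avg (fun j => cnt j s ^+ 2)) <= kappa + kappa ^+ 2.
Proof.
move=> mk.
apply: (@le_trans _ _ (seq_mean m (fun s => n%:R^-1 * collision_dev s + (kappa + kappa ^+ 2)))).
  by apply: le_seq_mean => s sm; apply: avg_cnt_sqr_le; rewrite sm.
by rewrite seq_meanD seq_meanZ seq_mean_collision_dev seq_mean_cst// mulr0 add0r.
Qed.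

(** The cross term averages to zero, so each draw adds four times the variance of the urn contents,
    which is at most four times their second moment. *)
Lemma seq_mean_collision_dev_sqr m : (m <= k * n)%N ->
  seq_mean m (fun s => collision_dev s ^+ 2) <= 4 * m%:R * (kappa + kappa ^+ 2).
Proof.
elim: m => [_|m IH mk].
  rewrite /= /collision_dev big1 /= ?mul0r ?subr0 ?expr0n ?mulr0 ?mul0r// => j _.
  by rewrite /cnt expr0n.
rewrite /=.
have E s : avg (fun i => collision_dev (i :: s) ^+ 2) =
    collision_dev s ^+ 2 + 4 * (avg (fun j => cnt j s ^+ 2) - tau s ^+ 2).
  have -> : (fun i => collision_dev (i :: s) ^+ 2) =
    (fun i => (collision_dev s ^+ 2 - 4 * collision_dev s * tau s + 4 * tau s ^+ 2) +
      ((4 * collision_dev s - 8 * tau s) * cnt i s + 4 * cnt i s ^+ 2)).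
    by apply/funext => i; rewrite collision_dev_cons; ring.
  by rewrite avgD avg_cst// avgD !avgZ avg_cnt//; ring.
apply: (@le_trans _ _ (seq_mean m (fun s => collision_dev s ^+ 2 +
    4 * avg (fun j => cnt j s ^+ 2)))).
  by apply: le_seq_mean => s _; rewrite E lerD2l ler_wpM2l// gerBl sqr_ge0.
rewrite seq_meanD seq_meanZ.
have h1 := IH (ltnW mk); have h2 := seq_mean_cnt_sqr_le m (ltnW mk).
by rewrite -[in leRHS]natr1; lra.
Qed.

(** Up to the small term [tau s / n], the quantity is [collision_dev s / n], whose second moment is
    of order [1 / n]. *)
Lemma seq_mean_dev_le m (r : R) : 1 <= r -> r ^+ 2 = n%:R -> (m <= k * n)%N ->
  seq_mean m (fun s => `|avg (fun j => cnt j s ^+ 2) - tau s ^+ 2 - tau s|) <=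
  ((4 * kappa * (kappa + kappa ^+ 2) + 1) / 2 + kappa) / r.
Proof.
move=> r1 rn mk.
have r0 : 0 < r by exact: lt_le_trans r1.
(* The inequality [2 * w * r <= w ^+ 2 + r ^+ 2] stands in for Cauchy-Schwarz; [r], the square root
   of [n], is the scale of [collision_dev]. *)
apply: (@le_trans _ _ (seq_mean m (fun s =>
    (2 * r ^+ 3)^-1 * collision_dev s ^+ 2 + ((2 * r)^-1 + kappa / r)))).
  apply: le_seq_mean => s sm.
  have tk : tau s <= kappa by apply: tau_le; rewrite sm.
  have t0 : 0 <= tau s by exact: tau_ge0.
  have -> : avg (fun j => cnt j s ^+ 2) - tau s ^+ 2 - tau s =
     collision_dev s / r ^+ 2 - tau s / r ^+ 2 by rewrite avg_cnt_sqr -rn; ring.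
  rewrite (le_trans (ler_normB _ _))// addrA lerD//.
    rewrite normrM (gtr0_norm (_ : 0 < (r ^+ 2)^-1)) ?invr_gt0 ?exprn_gt0//.
    rewrite -(real_normK (num_real (collision_dev s))).
    set w := `|collision_dev s|.
    rewrite -subr_ge0.
    have -> : (2 * r ^+ 3)^-1 * w ^+ 2 + (2 * r)^-1 - w / r ^+ 2 =
      (w - r) ^+ 2 / (2 * r ^+ 3) by field; rewrite gt_eqF.
    by rewrite divr_ge0 ?sqr_ge0// mulr_ge0// exprn_ge0// ltW.
  rewrite ger0_norm; last by rewrite divr_ge0// exprn_ge0// ltW.
  apply: ler_pM => //; first by rewrite invr_ge0 exprn_ge0// ltW.
  by rewrite lef_pV2 ?posrE ?exprn_gt0// expr2 ler_peMr// ltW.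
rewrite seq_meanD seq_meanZ seq_mean_cst//.
have i0 : 0 <= (2 * r ^+ 3)^-1 by rewrite invr_ge0 mulr_ge0// exprn_ge0// ltW.
have h := ler_wpM2l i0 (seq_mean_collision_dev_sqr m mk).
have k0 : 0 <= kappa + kappa ^+ 2 by rewrite addr_ge0// exprn_ge0.
have mk' : m%:R <= kappa * r ^+ 2 by rewrite rn -natrM ler_nat.
have h2 : (2 * r ^+ 3)^-1 * (4 * m%:R * (kappa + kappa ^+ 2)) <=
   (2 * r ^+ 3)^-1 * (4 * (kappa * r ^+ 2) * (kappa + kappa ^+ 2)).
  by apply: ler_wpM2l => //; apply: ler_wpM2r => //; apply: ler_wpM2l.
have -> : ((4 * kappa * (kappa + kappa ^+ 2) + 1) / 2 + kappa) / r =
  (2 * r ^+ 3)^-1 * (4 * (kappa * r ^+ 2) * (kappa + kappa ^+ 2)) + ((2 * r)^-1 + kappa / r).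
  by field; rewrite gt_eqF.
by rewrite lerD2r; exact: le_trans h2.
Qed.

(* [c ^ 3 <= 8 ^ c], and the average of [8 ^ c] grows by the factor [1 + 7 / n]. *)
Lemma seq_mean_cube_le m : (m <= k * n)%N ->
  seq_mean m (fun s => avg (fun j => cnt j s ^+ 3)) <= expR (7 * kappa).
Proof.
move=> mk.
have exp8 : seq_mean m (fun s : seq 'I_n => avg (fun j => 8 ^+ count_mem j s)) = (1 + 7 / n%:R) ^+ m :> R.
  elim: m {mk} => [|m IH].
    by rewrite /= !expr0; exact: (avg_cst n0 (1 : R)).
  rewrite /= exprS -IH -seq_meanZ; apply: eq_seq_mean => s _.
  have E i : avg (fun j => 8 ^+ count_mem j (i :: s)) =
      avg (fun j => 8 ^+ count_mem j s) + 7 / n%:R * 8 ^+ count_mem i s :> R.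
    rewrite /avg (bigD1 i)//= [in RHS](bigD1 i)//= eqxx add1n exprS.
    rewrite (eq_bigr (fun j => 8 ^+ count_mem j s)); last first.
      by move=> j ji; rewrite eq_sym (negbTE ji).
    by ring.
  transitivity (avg (fun i => avg (fun j => 8 ^+ count_mem j s) + 7 / n%:R * 8 ^+ count_mem i s) : R).
    by congr avg; apply/funext => i; exact: E.
  by rewrite avgD avg_cst// avgZ; ring.
apply: (@le_trans _ _ (seq_mean m (fun s => avg (fun j => 8 ^+ count_mem j s)))).
  apply: le_seq_mean => s _; apply: le_avg => j.
  rewrite /cnt -!natrX ler_nat; set c := count_mem j s.
  have -> : (8 ^ c = (2 ^ c) ^ 3)%N by rewrite -!expnM mulnC expnM.
  by rewrite leq_exp2r// ltnW// ltn_expl.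
rewrite exp8.
have h7 : 0 <= 7 / n%:R :> R by rewrite divr_ge0.
apply: (@le_trans _ _ (expR (7 / n%:R) ^+ m)).
  by apply: lerXn2r; rewrite ?nnegrE ?addr_ge0 ?expR_ge0// expR_ge1Dx.
rewrite -expRM_natl ler_expR.
have -> : m%:R * (7 / n%:R) = 7 * (m%:R / n%:R) :> R by ring.
by rewrite ler_wpM2l// ler_pdivrMr// -natrM ler_nat.
Qed.
End moments.

(** * Cosine averages of the log-likelihood ratio *)

Section cosine_average.
Context {R : realType} {n : nat}.
Hypothesis n0 : (0 < n)%N.
Variables (k : nat) (beta r : R).
Hypotheses (beta0 : 0 < beta) (r1 : 1 <= r) (rn : r ^+ 2 = n%:R) (alpha1 : 1 <= beta * r).
Let nR0 : 0 < n%:R :> R. Proof. by rewrite ltr0n. Qed.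
Let r0 : 0 < r. Proof. exact: lt_le_trans r1. Qed.
Local Notation alpha := (beta * r).
Let alpha0 : 0 < alpha. Proof. exact: mulr_gt0. Qed.
Local Notation eps := (alpha^-1).
Let eps01 : 0 < eps <= 1.
Proof. by rewrite invr_gt0 alpha0 invf_le1. Qed.
Local Notation kappa := (k%:R : R).
Local Notation cnt := (@cnt R n).
Local Notation tau := (@tau R n).
Local Notation X := (@neg_log_ratio R n alpha).

(** With [x - x ^+ 2 / 2 <= ln (1 + x) <= x], the linear terms cancel on average and only the second
    moment of the contents remains. *)
Lemma seq_mean_neg_log_ratio_le m : (m <= k * n)%N ->
  seq_mean m X <= m%:R * (eps ^+ 2 * (kappa + kappa ^+ 2) / 2).
Proof.
elim: m => [_|m IH mk]; first by rewrite /= mul0r.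
apply: (@le_trans _ _ (seq_mean m (fun s => X s + eps ^+ 2 / 2 * avg (fun j => cnt j s ^+ 2)))).
  rewrite [leLHS]/=; apply: le_seq_mean => s _.
  apply: (@le_trans _ _ (avg (fun j => (X s + eps * tau s) + (- eps * cnt j s + eps ^+ 2 / 2 * cnt j s ^+ 2)))).
    apply: le_avg => j.
    have e0 : 0 <= eps by rewrite invr_ge0 ltW.
    have c0 : 0 <= cnt j s * eps by rewrite mulr_ge0// cnt_ge0.
    have t0 : 0 <= tau s * eps by rewrite mulr_ge0// tau_ge0.
    have /andP[b1 _] := ln1D_bounds _ c0; have /andP[_ b2] := ln1D_bounds _ t0.
    rewrite exprMn in b1; lra.
  by rewrite avgD avg_cst// avgD !avgZ avg_cnt//; lra.
rewrite seq_meanD seq_meanZ -[m.+1%:R]natr1.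
have h1 := IH (ltnW mk); have h2 := @seq_mean_cnt_sqr_le R n n0 k m (ltnW mk).
have e2 : 0 <= eps ^+ 2 / 2 by rewrite divr_ge0// sqr_ge0.
apply: (le_trans (lerD h1 (ler_wpM2l e2 h2))); lra.
Qed.

(** Since [|x| <= x + 2 * expR (- x)] and the likelihood ratio has mean 1, an upper bound on the
    mean of [X] suffices. *)
Lemma seq_mean_norm_le :
  seq_mean (k * n) (fun s => `|X s|) <= kappa * (kappa + kappa ^+ 2) / (2 * beta ^+ 2) + 2.
Proof.
apply: (@le_trans _ _ (seq_mean (k * n) (fun s => X s + 2 * expR (- X s)))).
  apply: le_seq_mean => s _.
  have := expR_ge1Dx (- X s); have := expR_ge0 (- X s).
  by move=> h1 h2; have [x0|x0] := leP 0 (X s); [rewrite ger0_norm//|rewrite ltr0_norm//]; lra.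
rewrite seq_meanD seq_meanZ seq_mean_ratio// mulr1 lerD2r.
apply: (le_trans (seq_mean_neg_log_ratio_le _ (leqnn _))).
rewrite natrM -rn le_eqVlt; apply/orP; left; apply/eqP; field.
by rewrite !gt_eqF.
Qed.

(* The sum of [eps ^ 2 * i / n] over [i < m]. *)
Definition total_var m : R := eps ^+ 2 * (m%:R * (m%:R - 1) / 2) / n%:R.
Local Notation V := total_var.

Let VS m : V m.+1 = V m + eps ^+ 2 * (m%:R / n%:R).
Proof. by rewrite /total_var -[m.+1%:R]natr1; field; rewrite !gt_eqF. Qed.

Let V_le m : (m <= k * n)%N -> V m <= kappa ^+ 2 / beta ^+ 2.
Proof.
move=> mk.
have h : m%:R <= kappa * r ^+ 2 by rewrite rn -natrM ler_nat.
have h2 : m%:R * (m%:R - 1) / 2 <= (kappa * r ^+ 2) ^+ 2.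
  have m0 : 0 <= m%:R :> R by [].
  have : m%:R ^+ 2 <= (kappa * r ^+ 2) ^+ 2.
    by apply: lerXn2r; rewrite ?nnegrE//; apply: le_trans h.
  nra.
have -> : kappa ^+ 2 / beta ^+ 2 = eps ^+ 2 * (kappa * r ^+ 2) ^+ 2 / r ^+ 2.
  by field; rewrite !gt_eqF.
rewrite /total_var -rn ler_wpM2r ?invr_ge0 ?exprn_ge0 ?(ltW r0)//.
by rewrite ler_wpM2l// sqr_ge0.
Qed.

(** A bound on [expR (a ^+ 2 * V m / 2)], times the constant of one draw, times the moment bounds
    with the powers of [r] taken out; it does not depend on [n]. *)
Definition char_const (a : R) : R :=
  expR (a ^+ 2 * (kappa ^+ 2 / beta ^+ 2) / 2) *
  ((step_const a kappa + a ^+ 4 * kappa ^+ 2) *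
   (((4 * kappa * (kappa + kappa ^+ 2) + 1) / 2 + kappa) / beta ^+ 2 +
    (1 + expR (7 * kappa)) / beta ^+ 3)).

(** By [step_avg], one more draw multiplies the cosine by [expR (- (a ^+ 2 * v / 2))] once its phase
    is corrected by [- a * v / 2]; [W] compensates both effects. The error terms, [eps ^+ 2 / r] and
    [eps ^+ 3], are both of order [r ^- 3]. *)
Lemma char_step a phi m : (m < k * n)%N ->
  let W m := seq_mean m (fun s => expR (a ^+ 2 * V m / 2) * cos (a * X s + (phi - a * V m / 2))) in
  `|W m.+1 - W m| <= char_const a / r ^+ 3.
Proof.
move=> mk; cbv zeta.
set C := step_const a kappa + a ^+ 4 * kappa ^+ 2.
have C0 : 0 <= C.
  have a1 := normr_ge0 a; have k3 : 0 <= kappa ^+ 3 by exact: exprn_ge0.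
  have a3 : 0 <= `|a| ^+ 3 by exact: exprn_ge0.
  have a2 := sqr_ge0 a.
  rewrite /C /step_const; apply: addr_ge0; first apply: addr_ge0; apply: mulr_ge0.
  - by apply: addr_ge0; [exact: addr_ge0|exact: mulr_ge0].
  - exact: addr_ge0.
  - exact: a2.
  - by apply: addr_ge0 => //; exact: sqr_ge0.
  - by rewrite (exprM a 2 2) sqr_ge0.
  - exact: sqr_ge0.
set e := expR (a ^+ 2 * V m.+1 / 2).
have e0 : 0 < e by exact: expR_gt0.
pose B s := C * (eps ^+ 2 * `|avg (fun j => cnt j s ^+ 2) - tau s ^+ 2 - tau s| +
     eps ^+ 3 * (1 + avg (fun j => cnt j s ^+ 3))).
pose dif s := avg (fun j => cos (a * X (j :: s) + (phi - a * V m.+1 / 2))) -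
  expR (- (a ^+ 2 * (eps ^+ 2 * tau s) / 2)) * cos (a * X s + (phi - a * V m / 2)).
have difB s : size s = m -> `|dif s| <= B s.
  move=> sm.
  have tk : avg (fun j => cnt j s) <= kappa by rewrite avg_cnt// tau_le// sm ltnW.
  have := @step_avg R n (fun j => cnt j s) (a * X s + (phi - a * V m / 2)) a eps kappa
    (tau s) (eps ^+ 2 * tau s) n0 (fun j => cnt_ge0 j s) tk eps01 _ erefl.
  rewrite avg_cnt// => /(_ erefl); rewrite /dif /B -/C; congr (`|_ - _| <= _).
  congr avg; apply/funext => j; congr cos.
  have -> : V m.+1 = V m + eps ^+ 2 * tau s by rewrite VS /tau sm.
  by rewrite [X (j :: s)]/=; ring.
(* The later weight [e] is factored out; the earlier weight is [e] times the decay of one draw,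
   which is the factor built into [dif]. *)
have -> : seq_mean m.+1 (fun s => e * cos (a * X s + (phi - a * V m.+1 / 2))) -
   seq_mean m (fun s => expR (a ^+ 2 * V m / 2) * cos (a * X s + (phi - a * V m / 2))) =
   e * seq_mean m dif.
  rewrite -seq_meanZ [seq_mean m.+1 _]/=.
  set f := (fun s => avg _); set g := (fun s => _ * cos _).
  have -> : seq_mean m f - seq_mean m g = seq_mean m (fun s => f s + -1 * g s).
    by rewrite seq_meanD (seq_meanZ m (-1) g) mulN1r.
  apply: eq_seq_mean => s sm; rewrite /f /g avgZ /dif mulrBr mulN1r; congr (_ - _).
  rewrite [RHS]mulrA -expRD; congr (expR _ * _).
  have -> : V m.+1 = V m + eps ^+ 2 * tau s by rewrite VS /tau sm.
  by ring.
rewrite normrM (gtr0_norm e0).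
have -> : char_const a / r ^+ 3 = expR (a ^+ 2 * (kappa ^+ 2 / beta ^+ 2) / 2) *
  (C * (eps ^+ 2 * (((4 * kappa * (kappa + kappa ^+ 2) + 1) / 2 + kappa) / r) +
    eps ^+ 3 * (1 + expR (7 * kappa)))).
  by rewrite /char_const -/C; field; rewrite !gt_eqF.
apply: ler_pM => //; first exact: ltW.
  by rewrite ler_expR ler_wpM2r// ler_wpM2l ?sqr_ge0// V_le.
apply: (le_trans (seq_mean_norm _ _)).
apply: (le_trans (le_seq_mean _ _ _ difB)).
rewrite /B seq_meanZ seq_meanD !seq_meanZ seq_meanD seq_mean_cst//.
apply: ler_wpM2l => //; apply: lerD; apply: ler_wpM2l.
- exact: sqr_ge0.
- exact: seq_mean_dev_le (ltnW mk).
- by rewrite exprn_ge0// invr_ge0 ltW.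
- by rewrite lerD2l; exact: seq_mean_cube_le (ltnW mk).
Qed.

(** The one-draw errors are summed: there are [k * n], that is [k * r ^+ 2], of them, each of order
    [r ^- 3]. *)
Lemma char_bound a phi :
  `|seq_mean (k * n) (fun s => cos (a * X s + phi)) -
    expR (- (a ^+ 2 * V (k * n) / 2)) * cos (phi + a * V (k * n) / 2)| <=
  kappa * char_const a / r.
Proof.
(* With this starting phase the correction brings the phase back to [phi] after the last draw, while
   [W 0] is [cos psi]. *)
pose psi := phi + a * V (k * n) / 2.
pose W m := seq_mean m (fun s => expR (a ^+ 2 * V m / 2) * cos (a * X s + (psi - a * V m / 2))).
have W0 : W 0%N = cos psi.
  have V0 : V 0 = 0 by rewrite /total_var !mul0r mulr0 mul0r.
  by rewrite /W /= V0 !mulr0 !mul0r expR0 mul1r subr0 add0r.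
have Wm m : (m <= k * n)%N -> `|W m - cos psi| <= m%:R * (char_const a / r ^+ 3).
  elim: m => [_|m IH mk]; first by rewrite W0 subrr normr0 mul0r.
  have h1 := IH (ltnW mk); have h2 := char_step a psi m mk.
  rewrite (le_trans (ler_distD (W m) _ _))// -[m.+1%:R]natr1 mulrDl mul1r addrC.
  exact: lerD.
have := Wm _ (leqnn _).
rewrite /W seq_meanZ; set e := expR _; set S := seq_mean _ _.
have -> : S = seq_mean (k * n) (fun s => cos (a * X s + phi)).
  by apply: eq_seq_mean => s _; congr cos; rewrite /psi; ring.
move=> h.
have e0 : 0 < e by exact: expR_gt0.
(* Dividing by [e >= 1] does not enlarge the error. *)
have e1 : 1 <= e.
  rewrite -expR0 ler_expR divr_ge0// mulr_ge0 ?sqr_ge0// /total_var.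
  rewrite divr_ge0// mulr_ge0 ?sqr_ge0// divr_ge0//.
  by case: (k * n)%N => [|m]; rewrite ?mul0r// mulr_ge0// -[m.+1%:R]natr1 addrK.
rewrite expRN -/e -/psi; set T := seq_mean _ _ in h *.
have -> : T - e^-1 * cos psi = e^-1 * (e * T - cos psi) by field; rewrite gt_eqF.
rewrite normrM gtr0_norm ?invr_gt0//.
have -> : kappa * char_const a / r = 1 * ((k * n)%:R * (char_const a / r ^+ 3)).
  by rewrite natrM -rn; field; rewrite gt_eqF.
apply: ler_pM => //; first by rewrite invr_ge0 ltW.
by rewrite invf_le1.
Qed.

(** The leading factor is the limit variance; the correction [1 / (k * n)] comes from [m * (m - 1)]
    in place of [m ^+ 2]. *)
Lemma char_varE : (0 < k)%N -> V (k * n) =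
  kappa ^+ 2 / (2 * beta ^+ 2) * (1 - (kappa * r ^+ 2)^-1).
Proof.
move=> k0; rewrite /total_var natrM -rn; field.
by rewrite !gt_eqF ?ltr0n.
Qed.
End cosine_average.

(** * The limit *)

Section limit.
Context {R : realType}.
Variables (k : nat) (beta : R) (N : nat).
Hypotheses (k0 : (0 < k)%N) (beta0 : 0 < beta).
Hypothesis N1 : forall n, 1 <= beta * Num.sqrt (n + N.+1)%:R.

(** Sizes start at [N.+1], so that there is always a vertex and [alpha >= 1], as the estimates on
    draws require. *)
Let r n : R := Num.sqrt (n + N.+1)%:R.
Let M n (f : R -> R) : R :=
  seq_mean (k * (n + N.+1)) (fun s => f (neg_log_ratio (n := n + N.+1) (beta * r n) s)).

Let nN0 n : (0 < n + N.+1)%N. Proof. by rewrite addnS. Qed.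
Let rn n : r n ^+ 2 = (n + N.+1)%:R. Proof. by rewrite sqr_sqrtr. Qed.
Let r1 n : 1 <= r n.
Proof. by rewrite -[leLHS]sqrtr1 ler_wsqrtr// ler1n. Qed.

Lemma mean_functional_seq_mean n : mean_functional (M n).
Proof.
split=> [c f g _ _|f g _ _ fg|].
- by rewrite /M seq_meanD seq_meanZ.
- by apply: le_seq_mean => s _; exact: fg.
- by rewrite /M seq_mean_cst.
Qed.

Lemma cvg_inv_size : (n + N.+1)%:R^-1 @[n --> \oo] --> (0 : R).
Proof.
have := @cvg_harmonic R; rewrite -(cvg_shiftn N) /=.
by apply: cvg_trans; apply: near_eq_cvg; near=> n; rewrite /harmonic /= addnS.
Unshelve. all: end_near. Qed.

Lemma cvg_inv_sqrt_size : (r n)^-1 @[n --> \oo] --> (0 : R).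
Proof.
have -> : (fun n => (r n)^-1) = (fun n => Num.sqrt ((n + N.+1)%:R^-1)).
  by apply/funext => n; rewrite sqrtrV.
rewrite -[X in _ --> X]sqrtr0.
apply: continuous_cvg; [exact: sqrt_continuous | exact: cvg_inv_size].
Qed.

(** By [char_bound], the mean is a continuous function of [V n] up to an error of order [1 / r n].
    The limit mean is half the limit variance because each draw has drift [v / 2]. *)
Lemma cvg_seq_mean_cos (a phi : R) :
  M n (fun x => cos (a * x + phi)) @[n --> \oo] -->
  expR (- ((a * Num.sqrt (k%:R ^+ 2 / (2 * beta ^+ 2))) ^+ 2 / 2)) *
    cos (a * (k%:R ^+ 2 / (4 * beta ^+ 2)) + phi).
Proof.
pose v2 : R := k%:R ^+ 2 / (2 * beta ^+ 2).
have v20 : 0 <= v2 by apply: divr_ge0; [exact: sqr_ge0 | apply: mulr_ge0 => //; exact: sqr_ge0].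
pose V n := v2 * (1 - k%:R^-1 * (n + N.+1)%:R^-1).
have Vv : V n @[n --> \oo] --> v2.
  rewrite -[X in _ --> X]mulr1 -[X in _ * X]subr0 -[X in _ - X](mulr0 k%:R^-1).
  apply: cvgMl_tmp; apply: cvgB; first exact: cvg_cst.
  by apply: cvgMl_tmp; exact: cvg_inv_size.
pose L n := expR (- (a ^+ 2 * V n / 2)) * cos (phi + a * V n / 2).
have -> : expR (- ((a * Num.sqrt v2) ^+ 2 / 2)) * cos (a * (k%:R ^+ 2 / (4 * beta ^+ 2)) + phi) =
    expR (- (a ^+ 2 * v2 / 2)) * cos (phi + a * v2 / 2).
  rewrite exprMn sqr_sqrtr//; congr (_ * cos _).
  by rewrite /v2; field; rewrite gt_eqF.
have LL : L n @[n --> \oo] --> expR (- (a ^+ 2 * v2 / 2)) * cos (phi + a * v2 / 2).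
  apply: cvgM.
    apply: continuous_cvg; first exact: continuous_expR.
    by apply: cvgN; apply: cvgMr_tmp; exact: cvgMl_tmp.
  apply: continuous_cvg; first exact: continuous_cos.
  by apply: cvgD; [exact: cvg_cst | apply: cvgMr_tmp; exact: cvgMl_tmp].
rewrite -[X in _ --> X]add0r.
have -> : (fun n => M n (fun x => cos (a * x + phi))) =
  (fun n => (M n (fun x => cos (a * x + phi)) - L n) + L n).
  by apply/funext => n; rewrite subrK.
apply: cvgD => //.
pose c := k%:R * char_const k beta a.
have bd n : `|M n (fun x => cos (a * x + phi)) - L n| <= c * (r n)^-1.
  have := char_bound (nN0 n) k beta (r n) beta0 (r1 n) (rn n) (N1 n) a phi.
  rewrite char_varE//.
  by rewrite rn [(k%:R * _)^-1]invfM.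
have c0 : c * (r n)^-1 @[n --> \oo] --> (0 : R).
  by rewrite -[X in _ --> X](mulr0 c); apply: cvgMl_tmp; exact: cvg_inv_sqrt_size.
apply: (@squeeze_cvgr _ _ _ _ (fun n => - (c * (r n)^-1)) (fun n => c * (r n)^-1)) => //.
- by near=> n; rewrite -ler_norml.
- by rewrite -oppr0; exact: cvgN.
Unshelve. all: end_near. Qed.

Lemma cvg_dTV :
  dTV (@palpha R (n + N.+1) k (beta * r n)) (@punif R (n + N.+1) k) @[n --> \oo] -->
  (\int[@lebesgue_measure R]_x (Num.max 0 (1 - expR (- x)) *
     normal_pdf (k%:R ^+ 2 / (4 * beta ^+ 2))
                (Num.sqrt (k%:R ^+ 2 / (2 * beta ^+ 2))) x))%R.
Proof.
set m := k%:R ^+ 2 / (4 * beta ^+ 2); set s := Num.sqrt _.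
have s0 : s != 0.
  rewrite gt_eqF// sqrtr_gt0; apply: divr_gt0; first by rewrite exprn_gt0// ltr0n.
  by apply: mulr_gt0 => //; exact: exprn_gt0.
have -> : (fun n => dTV (@palpha R (n + N.+1) k (beta * r n)) (@punif R (n + N.+1) k)) =
   (fun n => M n (fun x => Num.max 0 (1 - expR (- x)))).
  apply/funext => n; rewrite dTV_seq_mean//.
  by rewrite mulr_gt0//; exact: lt_le_trans (r1 n).
apply: (mean_cvg M _ _ mean_functional_seq_mean (mean_functional_normal m s s0)
  _ _ _ tame_posexp posexp_le1 posexp_lipschitz).
  move=> n; exact: (seq_mean_norm_le (nN0 n) k beta (r n) beta0 (r1 n) (rn n)).
move=> a phi; rewrite Rintegral_cos_normal_pdf//.
exact: cvg_seq_mean_cos.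
Qed.
End limit.

Theorem theorem1 (R : realType) (k : nat) (beta : R) :
  (0 < k)%N -> 0 < beta ->
  (fun n : nat =>
     (dTV (@palpha R n k (beta * Num.sqrt n%:R)) (@punif R n k))%:E)
    @ \oo -->
  ((2^-1)%:E *
    \int[normal_prob (k%:R ^+ 2 / (4 * beta ^+ 2))
                     (Num.sqrt (k%:R ^+ 2 / (2 * beta ^+ 2)))]_x
       (`|1 - expR (- x)|)%:E)%E.
Proof.
move=> k0 beta0.
have v20 : 0 < k%:R ^+ 2 / (2 * beta ^+ 2).
  apply: divr_gt0; first by rewrite exprn_gt0// ltr0n.
  by apply: mulr_gt0 => //; exact: exprn_gt0.
rewrite normal_tv_integral; last 2 first.
- by rewrite gt_eqF// sqrtr_gt0.
- by rewrite sqr_sqrtr ?(ltW v20)//; field; rewrite gt_eqF.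
(* [N.+1] exceeds [1 / beta ^+ 2], whence [alpha >= 1] for every size from [N.+1] on. *)
pose N := Num.truncn ((beta ^+ 2)^-1).
have N1 n : 1 <= beta * Num.sqrt (n + N.+1)%:R.
  have b1 : (beta ^+ 2)^-1 <= (n + N.+1)%:R.
    apply: (@le_trans _ _ N.+1%:R); first by rewrite ltW// truncnS_gt.
    by rewrite ler_nat leq_addl.
  rewrite -[beta in leRHS](@ger0_norm R)// ?(ltW beta0)// -sqrtr_sqr -sqrtrM ?sqr_ge0//.
  rewrite -[leLHS]sqrtr1 ler_wsqrtr// -ler_pdivrMl ?exprn_gt0//.
  by rewrite mulr1.
apply: cvg_EFin; first exact: nearW.
rewrite -(cvg_shiftn N.+1).
exact: cvg_dTV.
Qed.
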